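(* Let $k\ge 3$ be an integer and let $h\ge 2$ be an integer. Then $$\sum_{\substack{\chi \bmod k\\ \chi \text{ even}}}|L(2h,\chi)|^2=\frac{2^{4h-2}\pi^{4h}}{((2h)!)^2k^2}\,\phi(k)\,\Sigma_2',$$ where \begin{align*} \Sigma_2'=&\sum_{q_1=0}^{2h-2}\sum_{q_2=0}^{2h-2}\sum_{j=1}^{2h-q_1}\sum_{s=1}^{2h-q_2}\sum_{\alpha=1}^{2h-q_1-j+1}B_{q_1}B_{q_2}\binom{2h}{q_1}\binom{2h}{q_2}\binom{2h-q_1}{j}\binom{2h-q_2}{s}\\ &\times k^{-4h+q_1+q_2+j+s}A_{2h-q_1-j,\alpha}\Bigg[\Bigg(\sum_{\substack{\beta=1\\ \alpha+\beta\text{ even}}}^{2h-q_2-s+1}\sum_{c=0}^{\frac{\alpha+\beta}{2}}\sum_{d=0}^{\frac{\alpha+\beta-2c}{2}}(-1)^{c+d+\frac{\alpha+\beta}{2}}A_{2h-q_2-s,\beta}\\ &\times\frac{(\alpha+\beta)(\alpha+\beta-c-1)!}{2^{2c+1}c!(\alpha+\beta-2c)!}\binom{\frac{\alpha+\beta-2c}{2}}{d}SIN(\alpha+\beta-2d)\Bigg)\\ &+\Bigg(\sum_{\substack{\beta=1\\ \alpha+\beta\text{ odd}}}^{2h-q_2-s+1}\sum_{e=0}^{\frac{\alpha+\beta-1}{2}}\sum_{f=0}^{\frac{\alpha+\beta-2e-1}{2}}(-1)^{e+f+\frac{\alpha+\beta+1}{2}}A_{2h-q_2-s,\beta}\\ &\times\frac{(\alpha+\beta-e-1)!}{2^{2e+1}e!(\alpha+\beta-2e-1)!}\binom{\frac{\alpha+\beta-2e-1}{2}}{f}SIN(\alpha+\beta-2f-1)\Bigg)\Bigg].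 \end{align*}
   Context: A Dirichlet character $\chi$ mod $k$ is even if $\chi(-1)=1$; the sum on the left is over all even Dirichlet characters modulo $k$ (including the principal character, and not only primitive ones). $L(s,\chi)=\sum_{n=1}^\infty \chi(n)n^{-s}$ for $\Re(s)>1$. $\phi$ is Euler's totient function. $B_n$ denotes the $n$th Bernoulli number, with the convention $B_0=1$, $B_1=-\frac12$. For integers $q\ge 0$ and $1\le j\le q+1$, $$A_{q,j}:=\sum_{t=0}^{j-1}(-1)^{t+q}\binom{j-1}{t}(j-t)^q .$$ For an integer $n\ge 0$ (with $k$ fixed), $$SIN(n):=\sum_{\substack{1\le m\le k\\ (m,k)=1}}\frac{1}{\left(\sin\left(\frac{\pi m}{k}\right)\right)^{n}},$$ so $SIN(0)=\phi(k)$. *)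

(* Defs.v *)
From mathcomp Require Import all_boot all_order all_algebra.
From mathcomp Require Import all_fingroup all_solvable.
From mathcomp Require Import complex.
From mathcomp Require Import all_classical all_reals all_analysis.

Set Implicit Arguments.
Unset Strict Implicit.
Unset Printing Implicit Defensive.

Import Order.TTheory GRing.Theory Num.Theory.
Import numFieldNormedType.Exports.

Local Open Scope classical_set_scope.
Local Open Scope complex_scope.
Local Open Scope ring_scope.

(* The last clause forces chi 1 = 1, since chi 1 = chi 1 ^+ 2 is nonzero. *)
Definition is_dirichlet_char (R : realType) (k : nat) (chi : int -> R[i]) :
    Prop :=
  [/\ forall m n : int, chi (m * n) = chi m * chi n,
      forall n : int, chi (n + k%:Z) = chi n &
      forall n : int, (chi n != 0) = coprimez n k%:Z].

Definition even_dirichlet_chars (R : realType) (k : nat) :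
    set (int -> R[i]) :=
  [set chi | is_dirichlet_char k chi /\ chi (- 1) = 1].
Arguments even_dirichlet_chars R k : clear implicits.

Lemma dirichlet_char1 (R : realType) k (chi : int -> R[i]) :
  is_dirichlet_char k chi -> chi 1 = 1.
Proof.
case=> chiM _ chi0; apply: (@mulfI _ (chi 1)); last by rewrite -chiM !mulr1.
by rewrite chi0 /coprimez gcd1z.
Qed.

Lemma dirichlet_char_mod (R : realType) k (chi : int -> R[i]) (n : int) :
  is_dirichlet_char k chi -> chi (n %% k%:Z)%Z = chi n.
Proof.
case=> _ chiD _.
have chiDn m (a : nat) : chi (m + a%:Z * k%:Z) = chi m.
  elim: a => [|a IH]; first by rewrite mul0r addr0.
  by rewrite -[a.+1]addn1 PoszD mulrDl mul1r addrA chiD.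
rewrite [in RHS](divz_eq n k%:Z) addrC.
case: (n %/ k%:Z)%Z => a; first by rewrite chiDn.
rewrite NegzE mulNr -[LHS](chiDn _ a.+1).
by rewrite -[in LHS](subrK (a.+1%:Z * k%:Z) (n %% k%:Z)%Z) !chiDn.
Qed.

Lemma dirichlet_char_root (R : realType) k (chi : int -> R[i]) (n : nat) :
  is_dirichlet_char k chi -> root ('X * ('X ^+ totient k - 1)) (chi n%:Z).
Proof.
move=> chiP; have [chiM _ chi0] := chiP.
rewrite rootM !rootE !hornerE.
have [//|nz] := eqVneq (chi n%:Z) 0; rewrite /= subr_eq0; apply/eqP.
have chiX m : chi n%:Z ^+ m = chi (n ^ m)%N%:Z.
  elim: m => [|m IH]; first by rewrite expr0 (dirichlet_char1 chiP).
  by rewrite exprS IH -chiM -PoszM -expnS.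
rewrite chiX -(dirichlet_char_mod _ chiP) modz_nat.
have /Euler_exp_totient -> : coprime n k.
  by rewrite -[coprime n k]/(coprimez n k) -chi0.
by rewrite -modz_nat (dirichlet_char_mod _ chiP) (dirichlet_char1 chiP).
Qed.

Lemma finite_dirichlet_chars (R : realType) k : (0 < k)%N ->
  finite_set [set chi : int -> R[i] | is_dirichlet_char k chi].
Proof.
case: k => // k _.
set p : {poly R[i]} := 'X * ('X ^+ totient k.+1 - 1).
have p0 : p != 0.
  by rewrite mulf_neq0 ?polyX_eq0// -size_poly_gt0 size_XnsubC ?totient_gt0.
have [rs rsE] := closed_field_poly_normal p.
have mem chi n : is_dirichlet_char k.+1 chi -> chi n%:Z \in rs.
  move=> /dirichlet_char_root-/(_ n); rewrite -/p rsE rootZ ?lead_coef_eq0//.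
  by rewrite root_prod_XsubC.
pose G (g : {ffun 'I_k.+1 -> seq_sub rs}) (n : int) : R[i] :=
  ssval (g (inord `|(n %% k.+1%:Z)%Z|)).
apply: (@sub_finite_set _ _ (G @` setT)); last exact/finite_image/finite_finset.
move=> chi chiP; exists [ffun i : 'I_k.+1 => SeqSub (mem chi i chiP)] => //.
apply/funext => n; rewrite /G ffunE /= -[RHS](dirichlet_char_mod _ chiP).
rewrite inordK; first by rewrite gez0_abs ?modz_ge0.
by rewrite -ltz_nat gez0_abs ?modz_ge0// ltz_pmod.
Qed.

(* A sum over \in is 0 when infinitely many terms are nonzero; this rules that
   case out for the sum over the even characters mod k. *)
Lemma finite_even_dirichlet_chars (R : realType) k : (0 < k)%N ->
  finite_set (even_dirichlet_chars R k).
Proof.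
by move=> /(finite_dirichlet_chars R); apply: sub_finite_set => chi [].
Qed.

(* For n > 0, n ^ s = exp (s * ln n), split into modulus and argument. *)
Definition natcpow (R : realType) (n : nat) (s : R[i]) : R[i] :=
  (expR (complex.Re s * ln n%:R))%:C *
  (cos (complex.Im s * ln n%:R) +i* sin (complex.Im s * ln n%:R)).

(* The series starts at n = 1, hence the shift; the value is meaningful only
   for 1 < Re s. The regular module R[i]^o carries the topology of the complex
   modulus. *)
Definition dirichlet_L (R : realType) (s : R[i]) (chi : int -> R[i]) : R[i] :=
  limn (series (fun n : nat => chi n.+1%:Z * natcpow n.+1 (- s) : R[i]^o)).

(* B_n = - (sum_(i < n) 'C(n + 1, i) B_i) / (n + 1) for n > 0. *)
Fixpoint bernoulli_seq (n : nat) : seq rat :=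
  if n is n'.+1 then
    let s := bernoulli_seq n' in
    rcons s (- (\sum_(i < n) 'C(n.+1, i)%:R * s`_i) / n.+1%:R)
  else [:: 1].

Definition bernoulli (n : nat) : rat := (bernoulli_seq n)`_n.

Lemma bernoulli_seqS n : bernoulli_seq n.+1 =
  rcons (bernoulli_seq n)
    (- (\sum_(i < n.+1) 'C(n.+2, i)%:R * (bernoulli_seq n)`_i) / n.+2%:R).
Proof. by []. Qed.

Lemma size_bernoulli_seq n : size (bernoulli_seq n) = n.+1.
Proof. by elim: n => [//|n IH]; rewrite bernoulli_seqS size_rcons IH. Qed.

Lemma nth_bernoulli_seq n i : (i <= n)%N -> (bernoulli_seq n)`_i = bernoulli i.
Proof.
elim: n => [|n IH]; first by rewrite leqn0 => /eqP ->.
rewrite leq_eqVlt => /predU1P[-> //|ltin].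
by rewrite bernoulli_seqS nth_rcons size_bernoulli_seq ltin IH.
Qed.

Lemma bernoulli0 : bernoulli 0 = 1.
Proof. by []. Qed.

Lemma bernoulli_rec n : (0 < n)%N ->
  \sum_(i < n.+1) 'C(n.+1, i)%:R * bernoulli i = 0.
Proof.
case: n => // n _; rewrite big_ord_recr /=.
have -> : bernoulli n.+1 =
    - (\sum_(i < n.+1) 'C(n.+2, i)%:R * bernoulli i) / n.+2%:R.
  rewrite {1}/bernoulli bernoulli_seqS nth_rcons size_bernoulli_seq ltnn eqxx.
  congr (- _ / _); apply: eq_bigr => i _.
  by rewrite nth_bernoulli_seq // -ltnS.
by rewrite binSn mulrC divfK ?pnatr_eq0// subrr.
Qed.

Lemma bernoulli1 : bernoulli 1 = - 2^-1.
Proof. by rewrite /bernoulli /= big_ord1 /= mul1r. Qed.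

Definition Acoef (q j : nat) : int :=
  \sum_(0 <= t < j) (-1) ^+ (t + q) * 'C(j - 1, t)%:Z * (j%:Z - t%:Z) ^+ q.

Definition SIN (R : realType) (k n : nat) : R :=
  \sum_(1 <= m < k.+1 | coprime m k) 1 / (sin (pi * m%:R / k%:R)) ^+ n.

(* Every subtraction and halving of naturals below is exact: over the given
   ranges no difference is negative and every halved number is even. *)
Definition Sigma2' (R : realType) (k h : nat) : R :=
  \sum_(0 <= q1 < (2 * h - 2).+1)
  \sum_(0 <= q2 < (2 * h - 2).+1)
  \sum_(1 <= j < (2 * h - q1).+1)
  \sum_(1 <= s < (2 * h - q2).+1)
  \sum_(1 <= alpha < (2 * h - q1 - j + 1).+1)
    ratr (bernoulli q1) * ratr (bernoulli q2)
    * 'C(2 * h, q1)%:R * 'C(2 * h, q2)%:R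
    * 'C(2 * h - q1, j)%:R * 'C(2 * h - q2, s)%:R
    * k%:R ^ (- (4 * h)%N%:Z + q1%:Z + q2%:Z + j%:Z + s%:Z)
    * (Acoef (2 * h - q1 - j) alpha)%:~R
    * (\sum_(1 <= beta < (2 * h - q2 - s + 1).+1 | ~~ odd (alpha + beta))
       \sum_(0 <= c < ((alpha + beta)./2).+1)
       \sum_(0 <= d < ((alpha + beta - 2 * c)./2).+1)
         (-1) ^+ (c + d + (alpha + beta)./2)
         * (Acoef (2 * h - q2 - s) beta)%:~R
         * (((alpha + beta) * (alpha + beta - c - 1)`!)%:R
            / (2 ^ (2 * c + 1) * c`! * (alpha + beta - 2 * c)`!)%:R)
         * 'C((alpha + beta - 2 * c)./2, d)%:R
         * SIN R k (alpha + beta - 2 * d)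
       +
       \sum_(1 <= beta < (2 * h - q2 - s + 1).+1 | odd (alpha + beta))
       \sum_(0 <= e < ((alpha + beta - 1)./2).+1)
       \sum_(0 <= f < ((alpha + beta - 2 * e - 1)./2).+1)
         (-1) ^+ (e + f + (alpha + beta + 1)./2)
         * (Acoef (2 * h - q2 - s) beta)%:~R
         * ((alpha + beta - e - 1)`!%:R
            / (2 ^ (2 * e + 1) * e`! * (alpha + beta - 2 * e - 1)`!)%:R)
         * 'C((alpha + beta - 2 * e - 1)./2, f)%:R
         * SIN R k (alpha + beta - 2 * f - 1)).

(* Main.v *)
Require Import Defs.
From HB Require Import structures.
From mathcomp Require Import all_boot all_order all_algebra.
From mathcomp Require Import all_fingroup all_solvable mxrepresentation.
From mathcomp Require Import complex.
From mathcomp Require Import all_classical all_reals all_analysis.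
From mathcomp Require Import ring lra zify.

(* Write f_n(z) for the rational function equal to sum_l l^n z^l where that
   series converges; the coefficients A_{n,j} are, up to sign, those of f_n as
   a polynomial in u = 1/(1 - z).  Put H = 2h and w_m = exp(2 pi i m/k).

   For even chi, L(H, chi) is a constant times sum_m chi(m) f_{H-1}(w_m): the
   sum of f_{H-1} over the N-th roots of z^N is N^H f_{H-1}(z^N), so
   N^H sum_m chi(m) f_{H-1}(w_m) is a sum of chi(n) f_{H-1}(exp(2 pi i n/(kN)))
   over n mod kN; each of its terms is (H-1)! (i kN/(2 pi n))^H up to a relative
   error O(n/N), and N tends to infinity.

   Since f_{H-1}(w_m) is real and even in m, orthogonality of the even
   characters turns the second moment into phi(k) times a sum of squares
   f_{H-1}(w_m)^2 over the m prime to k.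

   The Bernoulli recursion gives f_{H-1} as the combination of the f_n over
   which Sigma_2' runs.  Expanding the square in powers of u, whose real parts
   are cos(ay)/(2 sin y)^a or sin(ay)/(2 sin y)^a up to sign with y = pi m/k,
   and expanding cos(ay) and sin(ay) by Chebyshev polynomials gives Sigma_2'. *)

Set Implicit Arguments.
Unset Strict Implicit.
Unset Printing Implicit Defensive.

Import Order.TTheory GRing.Theory Num.Theory.
Import numFieldNormedType.Exports.
Local Open Scope classical_set_scope.
Local Open Scope complex_scope.
Local Open Scope ring_scope.

(** * Umbral functionals on polynomials *)

Section UmbralPolynomials.
Variable F : numFieldType.
Implicit Types (p q : {poly F}) (a : nat -> F) (n : nat).

Lemma coef_comp_polyXD1 p n m : (size p <= m)%N ->
  (p \Po ('X + 1))`_n = \sum_(i < m) p`_i *+ 'C(i, n).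
Proof.
move=> pm; rewrite coef_comp_poly (big_ord_widen m (fun i => p`_i * (('X + 1) ^+ i)`_n)) //.
rewrite big_mkcond /=; apply: eq_bigr => i _.
have -> : (('X + 1) ^+ i : {poly F})`_n = 'C(i, n)%:R.
  rewrite addrC exprDn coef_sum.
  under eq_bigr do rewrite expr1n mul1r coefMn coefXn.
  case: (ltnP n i.+1) => ni.
    rewrite (bigD1 (Ordinal ni)) //= eqxx big1 ?addr0 // => j.
    by rewrite -val_eqE /= eq_sym => /negbTE ->; rewrite mul0rn.
  rewrite bin_small // big1 // => j _; case: eqP => [e|]; last by rewrite mul0rn.
  by move: (ltn_ord j); rewrite -e ltnNge ni.
case: ltnP => [_|h]; first by rewrite mulr_natr.
by rewrite (nth_default _ h) mul0rn.
Qed.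

Lemma size_comp_polyXD1 p : size (p \Po ('X + 1)) = size p.
Proof. by rewrite size_comp_poly2 // size_XaddC. Qed.

Definition delta p := p \Po ('X + 1) - p.

Lemma coef_delta p n : (size p <= n.+2)%N -> (delta p)`_n = p`_n.+1 *+ n.+1.
Proof.
move=> pn; rewrite coefB (coef_comp_polyXD1 _ pn) !big_ord_recr /=.
rewrite big1 => [|i _]; last by rewrite bin_small // mulr0n.
by rewrite binn binSn mulr1n add0r addrAC subrr add0r.
Qed.

Lemma size_delta p n : (size p <= n.+1)%N -> (size (delta p) <= n)%N.
Proof.
move=> pn; apply/leq_sizeP => j nj; rewrite coef_delta ?nth_default ?mul0rn //.
  exact: leq_trans pn _.
by apply: leq_trans pn _; rewrite !ltnS (leq_trans nj).
Qed.

(** The linear functional with moments [a]. Binomial recursions for [a] become functional equations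
    under X -> X + 1. *)
Definition umbral a p := \sum_(i < size p) p`_i * a i.

Lemma umbralE a p m : (size p <= m)%N -> umbral a p = \sum_(i < m) p`_i * a i.
Proof.
move=> pm; rewrite /umbral (big_ord_widen m (fun i => p`_i * a i)) //.
rewrite big_mkcond; apply: eq_bigr => i _; case: ltnP => // h.
by rewrite (nth_default _ h) mul0r.
Qed.

Lemma umbral_is_linear a : scalar (umbral a).
Proof.
move=> c p q; pose m := maxn (size p) (size q).
rewrite !(@umbralE _ _ m) ?leq_maxl ?leq_maxr //.
  rewrite mulr_sumr -big_split; apply: eq_bigr => i _ /=.
  by rewrite coefD coefZ mulrDl mulrA.
rewrite (leq_trans (size_polyD _ _)) // geq_max leq_maxr andbT.
by rewrite (leq_trans (size_scale_leq _ _)) ?leq_maxl.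
Qed.

HB.instance Definition _ a := GRing.isLinear.Build F {poly F} F _ (umbral a)
  (umbral_is_linear a).

Lemma umbralXn a n : umbral a 'X^n = a n.
Proof.
rewrite (@umbralE _ _ n.+1) ?size_polyXn // big_ord_recr /= coefXn eqxx mul1r.
by rewrite big1 ?add0r // => i _; rewrite coefXn ltn_eqF ?mul0r.
Qed.

Lemma umbral_comp_polyXD1 a p : umbral a (p \Po ('X + 1)) =
  \sum_(i < size p) p`_i * \sum_(j < i.+1) 'C(i, j)%:R * a j.
Proof.
rewrite (@umbralE _ _ (size p)) ?size_comp_polyXD1 //.
under eq_bigr do rewrite (@coef_comp_polyXD1 _ _ (size p)) // mulr_suml.
rewrite exchange_big; apply: eq_bigr => i _ /=; rewrite mulr_sumr.
rewrite (big_ord_widen (size p) (fun j => p`_i * ('C(i, j)%:R * a j))) //.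
rewrite [RHS]big_mkcond; apply: eq_bigr => j _ /=.
by case: ltnP => [_|h]; [rewrite mulrA mulr_natr|rewrite bin_small // mulr0n mul0r].
Qed.

(** Modelled on p -> sum_(l >= 0) p(l) z^l, where shifting l by one drops the term p(0); the
    hypothesis is the case of monomials. *)
Lemma umbral_shift a z :
  (forall n, a n = z * (\sum_(j < n.+1) 'C(n, j)%:R * a j) + (n == 0)%:R) ->
  forall p, z * umbral a (p \Po ('X + 1)) = umbral a p - p.[0].
Proof.
move=> aE p; rewrite umbral_comp_polyXD1 mulr_sumr.
have -> : p.[0] = \sum_(i < size p) p`_i * ((i : nat) == 0)%:R.
  by rewrite horner_coef; apply: eq_bigr => i _; rewrite expr0n.
by rewrite -sumrB; apply: eq_bigr => i _; rewrite (aE i) mulrCA -mulrBr addrK.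
Qed.

(** Either functional satisfies (1 - z) w(p) = z w(delta p) + p(0), and [delta] lowers the degree,
    so induction on the size determines it. *)
Lemma umbral_eq (z : F) (u v : {poly F} -> F) : z != 1 ->
    {morph u : p q / p - q} -> {morph v : p q / p - q} ->
    (forall p, z * u (p \Po ('X + 1)) = u p - p.[0]) ->
    (forall p, z * v (p \Po ('X + 1)) = v p - p.[0]) ->
  u =1 v.
Proof.
move=> z1 uB vB uE vE p; have [n] := ubnP (size p); elim: n p => // n IH p pn.
have D w : {morph w : p q / p - q} -> z * w (p \Po ('X + 1)) = w p - p.[0] ->
    (1 - z) * w p = z * w (delta p) + p.[0].
  by move=> wB h; rewrite wB mulrBr h; ring.
have : (1 - z) * u p = (1 - z) * v p.
  rewrite (D u uB (uE p)) (D v vB (vE p)); congr (_ * _ + _).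
  case: n => [|n] in IH pn *.
    move: pn; rewrite ltnS leqn0 size_poly_eq0 => /eqP ->.
    by rewrite /delta comp_poly0 uB vB !subrr.
  by rewrite IH // ltnS; apply: size_delta; rewrite -ltnS.
by apply: mulfI; rewrite subr_eq0 eq_sym.
Qed.

(** Every polynomial is a difference: subtracting [delta] of a suitable multiple of X^(n+1) removes
    the coefficient of X^n. *)
Lemma delta_eq (u v : {poly F} -> F) :
    {morph u : p q / p - q} -> {morph v : p q / p - q} ->
    (forall p, u (delta p) = v (delta p)) ->
  u =1 v.
Proof.
move=> uB vB uvE p; have [n] := ubnP (size p); elim: n p => // n IH p pn.
case: n => [|n] in IH pn *.
  move: pn; rewrite ltnS leqn0 size_poly_eq0 => /eqP ->.
  by rewrite -(subrr 0) uB vB !subrr.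
pose r : {poly F} := (p`_n / n.+1%:R) *: 'X^(n.+1).
have sr : (size r <= n.+2)%N.
  by rewrite (leq_trans (size_scale_leq _ _)) // size_polyXn.
have : u (p - delta r) = v (p - delta r).
  apply: IH; rewrite ltnS; apply/leq_sizeP => j; rewrite leq_eqVlt.
  case/predU1P => [<-|nj].
    rewrite coefB coef_delta // coefZ coefXn eqxx mulr1 -[_ *+ _]mulr_natr.
    by rewrite divfK ?pnatr_eq0 // subrr.
  rewrite nth_default //; apply: leq_trans nj.
  rewrite (leq_trans (size_polyD _ _)) // size_polyN geq_max -ltnS pn.
  exact: size_delta.
by rewrite uB vB uvE => /addIr.
Qed.

End UmbralPolynomials.

(** * The rational functions sum_l l^n z^l *)

Section FiniteDifferences.
Variable F : numFieldType.
Implicit Types (p : {poly F}) (g : nat -> F).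

(** The m-th forward difference at 0, indexed from the top as in [Acoef]. *)
Definition findiff m g : F :=
  \sum_(t < m.+1) (-1) ^+ t * 'C(m, t)%:R * g (m - t)%N.

Lemma findiffS m g :
  findiff m.+1 g = findiff m (fun n => g n.+1) - findiff m g.
Proof.
rewrite /findiff big_ord_recl /= expr0 !bin0 !mul1r subn0.
rewrite [X in _ = X - _]big_ord_recl /= expr0 !bin0 !mul1r subn0 -addrA; congr (_ + _).
under eq_bigr do rewrite /bump /= add1n subSS binS natrD mulrDr mulrDl.
rewrite big_split /= big_ord_recr /= (bin_small (ltnSn m)) mulr0 mul0r addr0.
congr (_ + _).
  by apply: eq_bigr => i _; rewrite /bump /= add1n subnSK.
by rewrite -sumrN; apply: eq_bigr => i _; rewrite exprS mulN1r !mulNr.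
Qed.

Lemma findiff_poly m p : (size p <= m.+1)%N ->
  findiff m (fun n => p.[n%:R]) = m`!%:R * p`_m.
Proof.
elim: m p => [|m IH] p pm.
  rewrite /findiff big_ord1 expr0 bin0 fact0 !mul1r subn0.
  by rewrite (size1_polyC pm) hornerC coefC.
rewrite findiffS -[LHS](_ : findiff m (fun n => (delta p).[n%:R]) = _).
  rewrite IH ?size_delta // coef_delta // factS natrM.
  by rewrite -[p`_m.+1 *+ _]mulr_natl mulrA [X in X * _]mulrC.
rewrite /findiff -sumrB; apply: eq_bigr => i _.
by rewrite hornerD hornerN horner_comp hornerD hornerX hornerC -mulrBr -natr1.
Qed.

End FiniteDifferences.

(** * Recursion, inversion and distribution relation for [efun] *)

Section Eulerian.
Variable F : numFieldType.
Implicit Types (z : F) (n : nat).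

(* The rational function equal to [\sum_l l ^+ n * z ^+ l] where that series
   converges. *)
Definition efun n z : F :=
  \sum_(i < n.+1) (-1) ^+ i * (Acoef n i.+1)%:~R * (1 - z)^-1 ^+ i.+1.

Lemma Acoef_findiff n i :
  (Acoef n i.+1)%:~R = findiff i (fun j => (- j.+1%:R) ^+ n) :> F.
Proof.
rewrite /Acoef big_mkord rmorph_sum; apply: eq_bigr => t _ /=.
have ti : (t <= i)%N by rewrite -ltnS.
rewrite subn1 /= !rmorphM /= !rmorphXn /= rmorphB /= rmorphN1 exprD.
by rewrite -subSn // natrB ?(leqW ti) // [X in _ = _ * X]exprNn -!pmulrn; ring.
Qed.

(** An i-th difference of a polynomial of degree n <= i sees only the coefficient of X^i. Hence
    [Acoef] vanishes for n < i and is a signed factorial for i = n. *)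
Lemma Acoef_poly n i : (n <= i)%N ->
  (Acoef n i.+1)%:~R = i`!%:R * ((-1) ^+ n *: ('X - (-1)%:P) ^+ n : {poly F})`_i.
Proof.
move=> ni; rewrite -findiff_poly ?size_scale ?signr_eq0 ?size_exp_XsubC ?ltnS //.
rewrite Acoef_findiff; apply: eq_bigr => t _.
by rewrite hornerZ horner_exp hornerXsubC opprK natr1 -exprNn.
Qed.

Lemma Acoef_eq0 n i : (n < i)%N -> (Acoef n i.+1)%:~R = 0 :> F.
Proof.
move=> ni; rewrite (Acoef_poly (ltnW ni)) nth_default ?mulr0 //.
by rewrite size_scale ?signr_eq0 // size_exp_XsubC.
Qed.

Lemma Acoef_diag n : (Acoef n n.+1)%:~R = (-1) ^+ n * n`!%:R :> F.
Proof.
rewrite Acoef_poly // coefZ mulrC -mulrA; congr (_ * _).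
have /monicP : ('X - (-1)%:P : {poly F}) ^+ n \is monic.
  by rewrite monic_exp // monicXsubC.
by rewrite lead_coefE size_exp_XsubC => ->; rewrite mul1r.
Qed.

Lemma efun_widen n m z : (n <= m)%N -> efun n z =
  \sum_(i < m.+1) (-1) ^+ i * (Acoef n i.+1)%:~R * (1 - z)^-1 ^+ i.+1.
Proof.
move=> nm; rewrite /efun.
rewrite (big_ord_widen m.+1
  (fun i => (-1) ^+ i * (Acoef n i.+1)%:~R * (1 - z)^-1 ^+ i.+1)) //.
rewrite big_mkcond; apply: eq_bigr => i _ /=; case: ltnP => // h.
by rewrite Acoef_eq0 // mulr0 mul0r.
Qed.

(** This is the shift of l in sum_l l^n z^l, checked on the coefficients of the powers of [u]. *)
Lemma efun_rec z n : z != 1 ->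
  efun n z = z * (\sum_(j < n.+1) 'C(n, j)%:R * efun j z) + (n == 0)%:R.
Proof.
move=> z1; set u := (1 - z)^-1.
have uz : z * u = u - 1.
  by rewrite -{1}[z](subKr 1) mulrBl mul1r mulfV // subr_eq0 eq_sym.
(* The same powers differenced from 0 instead of 1: each [Acoef] is a sum of two neighbouring [d],
   and z u = u - 1 then matches the two sides. *)
pose d i := findiff i (fun j => (- j%:R : F) ^+ n).
have dE i : (Acoef n i.+1)%:~R = d i.+1 + d i.
  by rewrite Acoef_findiff [d i.+1]findiffS subrK.
have dS : d n.+1 = 0.
  rewrite /d -[LHS](_ : findiff n.+1 (fun j => ((- 'X) ^+ n : {poly F}).[j%:R]) = _).
    have sp : size ((- 'X) ^+ n : {poly F}) = n.+1.
      by rewrite exprNn -signr_odd mulr_sign; case: odd; rewrite ?size_polyN size_polyXn.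
    by rewrite findiff_poly ?sp // nth_default ?sp ?mulr0.
  by apply: eq_bigr => t _; rewrite horner_exp hornerN hornerX.
have d0 : d 0 = (n == 0)%:R.
  by rewrite /d /findiff big_ord1 bin0 !mul1r subn0 oppr0 expr0n.
(* The binomial theorem for -j = 1 - (j + 1) collapses the combined coefficient of u^(i+1) to
   [d i]. *)
have -> : \sum_(j < n.+1) 'C(n, j)%:R * efun j z =
    \sum_(i < n.+1) (-1) ^+ i * d i * u ^+ i.+1.
  under eq_bigr => j _ do
    rewrite (@efun_widen j n) ?leq_ord // mulr_sumr.
  rewrite exchange_big; apply: eq_bigr => i _ /=.
  under eq_bigr do rewrite [X in _ * X]mulrC mulrCA mulrA -mulrA.
  under eq_bigr do rewrite mulrA [X in X * _]mulrC -mulrA mulrCA.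
  under eq_bigr do rewrite (mulrCA _ ((-1) ^+ i)).
  rewrite -mulr_sumr -mulr_sumr mulrC; congr (_ * _); congr (_ * _).
  under eq_bigr do rewrite Acoef_findiff /findiff mulr_sumr.
  rewrite exchange_big; apply: eq_bigr => t _ /=.
  under eq_bigr do rewrite mulrCA.
  rewrite -mulr_sumr; congr (_ * _).
  have -> : - (i - t)%:R = 1 + - (i - t).+1%:R :> F by rewrite -natr1; ring.
  rewrite exprDn; apply: eq_bigr => j _.
  by rewrite expr1n mul1r mulr_natl.
rewrite /efun; under eq_bigr do rewrite dE mulrDr mulrDl.
rewrite big_split /= big_ord_recr /= dS mulr0 mul0r addr0.
rewrite [X in _ + X]big_ord_recl [X in _ = z * X + _]big_ord_recl /= d0 mul1r.
rewrite [z * _]mulrDr expr1 mulrCA uz addrA addrAC addrC.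
rewrite -/u mulr_sumr.
have -> : \sum_(i < n) (-1) ^+ i * d i.+1 * u ^+ i.+1 +
   \sum_(i < n) (-1) ^+ bump 0 i * d (bump 0 i) * u ^+ (bump 0 i).+1 =
   \sum_(i < n) z * ((-1) ^+ bump 0 i * d (bump 0 i) * u ^+ (bump 0 i).+1).
  rewrite -big_split; apply: eq_bigr => i _ /=; rewrite /bump /= !add1n.
  rewrite [u ^+ i.+2]exprS [RHS]mulrCA (mulrA z u) uz [(-1) ^+ i.+1]exprS; ring.
ring.
Qed.

Lemma umbral_efun z p : z != 1 ->
  z * umbral (efun^~ z) (p \Po ('X + 1)) = umbral (efun^~ z) p - p.[0].
Proof. by move=> z1; apply: umbral_shift => n; apply: efun_rec. Qed.

(** Formally the sum of l^n z^l over all integers l vanishes. Here [v] stands for minus the part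
    over l < 0; it obeys the functional equation of the part over l >= 0, and [umbral_eq] identifies
    the two. *)
Lemma efun_inv z n : z != 0 -> z != 1 -> (0 < n)%N ->
  efun n z^-1 = (-1) ^+ n.+1 * efun n z.
Proof.
move=> z0 z1 n0; have zV1 : z^-1 != 1 by rewrite invr_eq1.
pose v (p : {poly F}) := p.[0] - umbral (efun^~ z^-1) (p \Po (- 'X)).
have vB : {morph v : p q / p - q}.
  by move=> p q; rewrite /v hornerD hornerN comp_polyB raddfB /=; ring.
have uB := raddfB (umbral (efun^~ z)).
have vE p : z * v (p \Po ('X + 1)) = v p - p.[0].
  pose r := p \Po (1 - 'X).
  have r1 : r \Po ('X + 1) = p \Po (- 'X).
    rewrite /r -comp_polyA comp_polyB comp_polyX comp_polyC; congr (_ \Po _).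
    by ring.
  have -> : v (p \Po ('X + 1)) = p.[1] - umbral (efun^~ z^-1) r.
    rewrite /v horner_comp -comp_polyA comp_polyD comp_polyX comp_polyC.
    by rewrite hornerD hornerX hornerC add0r [- 'X + _]addrC.
  have := umbral_efun r zV1; rewrite r1 => /eqP; rewrite eq_sym subr_eq => /eqP ->.
  have -> : r.[0] = p.[1] by rewrite horner_comp !hornerE subr0.
  by rewrite /v opprD addrCA subrr addr0 mulrN mulVKf // addrAC subrr sub0r.
have : umbral (efun^~ z) 'X^n = v 'X^n := umbral_eq z1 uB vB (fun p => umbral_efun p z1) vE 'X^n.
have NX : (- 'X) ^+ n = (-1) ^+ n *: 'X^n :> {poly F}.
  by rewrite [LHS]exprNn -[RHS]mul_polyC polyC_exp polyCN.
rewrite umbralXn /v hornerXn expr0n gtn_eqF // sub0r comp_Xn_poly NX.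
rewrite linearZ /= umbralXn => ->.
by rewrite exprS mulN1r mulrNN signrMK.
Qed.

Lemma efun_odd_inv n z : odd n -> z != 0 -> z != 1 -> efun n z^-1 = efun n z.
Proof.
by move=> on z0 z1; rewrite efun_inv //; [rewrite -signr_odd /= on mul1r|case: n on].
Qed.

Lemma sum_prim_root N (zeta : F) l : N.-primitive_root zeta -> (l < N)%N ->
  \sum_(i < N) (zeta ^+ i) ^+ l = (N * (l == 0))%:R.
Proof.
move=> zP lN; under eq_bigr do rewrite exprAC.
case: l => [|l] in lN *.
  by under eq_bigr do rewrite expr0 expr1n; rewrite sumr_const card_ord muln1.
have := subrX1 (zeta ^+ l.+1) N.
rewrite exprAC (prim_expr_order zP) expr1n subrr => /esym/eqP.
rewrite mulf_eq0 subr_eq0 -(prim_order_dvd zP) gtnNdvd //= muln0 => /eqP //.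
Qed.

Lemma umbral_efun_iter z N p : z != 1 ->
  z ^+ N * umbral (efun^~ z) (p \Po ('X + N%:R%:P)) =
  umbral (efun^~ z) p - \sum_(l < N) z ^+ l * p.[l%:R].
Proof.
move=> z1; elim: N => [|N IH].
  by rewrite big_ord0 subr0 expr0 mul1r mulr0n polyC0 addr0 comp_polyXr.
rewrite big_ord_recr /= opprD addrA -IH exprS.
have -> : p \Po ('X + N.+1%:R%:P) = p \Po ('X + N%:R%:P) \Po ('X + 1).
  rewrite -comp_polyA comp_polyD comp_polyX comp_polyC; congr (_ \Po _).
  by rewrite -natr1 polyCD addrAC addrA.
rewrite [z * _]mulrC -mulrA umbral_efun // mulrBr horner_comp.
by rewrite hornerD hornerX hornerC add0r.
Qed.

(** Averaging sum_l l^n z^l over the N-th roots keeps only the l divisible by N. The proof checks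
    that the rescaled average [v] obeys the functional equation at z^N. *)
Lemma efun_distr N (zeta z : F) n : N.-primitive_root zeta -> z ^+ N != 1 ->
  \sum_(i < N) efun n (zeta ^+ i * z) = N%:R ^+ n.+1 * efun n (z ^+ N).
Proof.
move=> zP zN1; have N0 := prim_order_gt0 zP.
have NF : N%:R != 0 :> F by rewrite pnatr_eq0 -lt0n.
have zE i : (zeta ^+ i * z) ^+ N = z ^+ N.
  by rewrite exprMn exprAC (prim_expr_order zP) expr1n mul1r.
have z1 i : zeta ^+ i * z != 1.
  by apply: contraNneq zN1 => e; rewrite -(zE i) e expr1n.
(* Scaling by 1/N turns the unit shift into a shift by N, to which [umbral_efun_iter] applies. *)
pose sc : {poly F} := N%:R^-1 *: 'X.
pose v (p : {poly F}) :=
  N%:R^-1 * \sum_(i < N) umbral (efun^~ (zeta ^+ i * z)) (p \Po sc).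
have vB : {morph v : p q / p - q}.
  move=> p q; rewrite /v -mulrBr -sumrB; congr (_ * _); apply: eq_bigr => i _.
  by rewrite comp_polyB raddfB.
have uB := raddfB (umbral (efun^~ (z ^+ N))).
have vE p : z ^+ N * v (p \Po ('X + 1)) = v p - p.[0].
  rewrite /v mulrCA mulr_sumr.
  have -> : p \Po ('X + 1) \Po sc = p \Po sc \Po ('X + N%:R%:P).
    rewrite -!comp_polyA comp_polyD comp_polyX comp_polyC comp_polyZ comp_polyX.
    congr (_ \Po _); rewrite scalerDr; congr (_ + _).
    by rewrite -[RHS]mul_polyC -polyCM mulVf.
  under eq_bigr => i _ do
    rewrite -[in X in X * _](zE i) umbral_efun_iter //.
  rewrite sumrB mulrBr; congr (_ - _).
  (* Summing over the roots of unity kills every l with 0 < l < N and leaves p(0). *)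
  rewrite exchange_big /=.
  rewrite (eq_bigr (fun l : 'I_N => z ^+ l * (p \Po sc).[l%:R] * (N * ((l : nat) == 0))%:R)).
    rewrite (bigD1 (Ordinal N0)) //= big1 ?addr0; last first.
      by move=> i; rewrite -val_eqE /= => /negbTE ->; rewrite muln0 mulr0.
    by rewrite muln1 mul1r horner_comp /sc hornerZ hornerX mulr0 mulrC mulfK.
  move=> l _; rewrite -(sum_prim_root zP (ltn_ord l)) mulr_sumr.
  by apply: eq_bigr => i _; rewrite exprMn; ring.
have : umbral (efun^~ (z ^+ N)) 'X^n = v 'X^n :=
  umbral_eq zN1 uB vB (fun p => umbral_efun p zN1) vE 'X^n.
rewrite umbralXn => ->.
rewrite /v exprSr -mulrA mulVKf // mulr_sumr; apply: eq_bigr => i _.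
by rewrite comp_Xn_poly /sc exprZn linearZ /= umbralXn exprVn mulVKf ?expf_neq0.
Qed.

End Eulerian.

(** * Bernoulli numbers *)

Section BernoulliOdd.

(** The Bernoulli recursion in umbral form; the right side is p'(0). *)
Lemma umbral_bernoulli_delta (p : {poly rat}) : umbral bernoulli (delta p) = p`_1.
Proof.
rewrite raddfB /= umbral_comp_polyXD1 /umbral -sumrB.
have -> : p`_1 = \sum_(i < size p) p`_i * ((i : nat) == 1)%:R.
  case: (ltnP 1 (size p)) => h.
    rewrite (bigD1 (Ordinal h)) //= mulr1 big1 ?addr0 // => i.
    by rewrite -val_eqE /= => /negbTE ->; rewrite mulr0.
  rewrite nth_default // big1 // => i _.
  by rewrite ltn_eqF ?mulr0 // (leq_trans (ltn_ord i)).
apply: eq_bigr => i _; rewrite -mulrBr; congr (_ * _).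
rewrite big_ord_recr /= binn mul1r addrK.
(* Degree 1 is the exception to the recursion and contributes B_0 = 1. *)
case: (i : nat) => [|[|n]]; first by rewrite big_ord0.
  by rewrite big_ord1 bin0 mul1r.
by rewrite bernoulli_rec.
Qed.

(** The functional is invariant under X -> -1 - X, since it takes equal values on differences. For
    odd n this gives B_n = - u((X + 1)^n), while u((X + 1)^n) = B_n for n different from 1. *)
Lemma bernoulli_odd n : odd n -> n != 1%N -> bernoulli n = 0.
Proof.
move=> on n1; pose u := umbral bernoulli.
pose v p := u (p \Po (- 1 - 'X)).
have uB : {morph u : p q / p - q} := raddfB (umbral bernoulli).
have vB : {morph v : p q / p - q} by move=> p q; rewrite /v comp_polyB uB.
have uv p : u (delta p) = v (delta p).
  have p1 (q : {poly rat}) : q`_1 = q^`().[0].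
    by rewrite horner_coef0 coef_deriv mulr1n.
  rewrite /v comp_polyB -comp_polyA comp_polyD comp_polyX comp_polyC.
  rewrite addrAC addNr add0r.
  have -> : p \Po (- 'X) - (p \Po (- 1 - 'X)) = - delta (p \Po (- 'X)).
    have NX : - 'X \Po ('X + 1) = - 1 - 'X :> {poly rat}.
      by rewrite -[X in X \Po _]sub0r comp_polyB comp_poly0 comp_polyX sub0r opprD addrC.
    by rewrite opprB -comp_polyA NX.
  rewrite /u raddfN /= !umbral_bernoulli_delta !p1 deriv_comp derivN derivX.
  by rewrite mulrN1 hornerN opprK horner_comp hornerN hornerX oppr0.
have : u 'X^n = v 'X^n := delta_eq uB vB uv 'X^n; rewrite {1}/u umbralXn /v comp_Xn_poly.
rewrite -opprD exprNn -signr_odd on expr1 mulN1r /u raddfN /= addrC.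
rewrite -comp_Xn_poly => h.
have := umbral_bernoulli_delta 'X^n; rewrite raddfB /= umbralXn coefXn eq_sym.
rewrite (negbTE n1) => /eqP; rewrite subr_eq0 => /eqP h2.
by move: h; rewrite /u h2 => /eqP; rewrite -subr_eq0 opprK -mulr2n mulrn_eq0 => /eqP.
Qed.

End BernoulliOdd.

(** * Inversion of a double sum by the Bernoulli recursion *)

Section BernoulliInversion.
Variable F : numFieldType.

(** With p = H - q - j and the binomials regrouped, the inner sum over q < H - p is the Bernoulli
    recursion, which vanishes unless p = H - 1. *)
Lemma bernoulli_inversion (H : nat) (k : F) (a : nat -> F) :
  (2 < H)%N -> ~~ odd H -> k != 0 ->
  \sum_(0 <= q < (H - 2).+1) \sum_(1 <= j < (H - q).+1)
    ratr (bernoulli q) * 'C(H, q)%:R * 'C(H - q, j)%:R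
    * k ^ (- H%:Z + q%:Z + j%:Z) * a (H - q - j)%N =
  H%:R * k ^- H.-1 * a H.-1.
Proof.
move=> H2 Hodd k0.
pose G q p := ratr (bernoulli q) * 'C(H, q)%:R * 'C(H - q, p)%:R * k ^- p * a p.
have inner q : (q <= H)%N -> \sum_(1 <= j < (H - q).+1)
    ratr (bernoulli q) * 'C(H, q)%:R * 'C(H - q, j)%:R
    * k ^ (- H%:Z + q%:Z + j%:Z) * a (H - q - j)%N = \sum_(0 <= p < H - q) G q p.
  move=> qH; rewrite big_add1 /= [RHS]big_nat_rev /=.
  apply: eq_big_nat => j /andP[_ jH]; rewrite /G add0n.
  congr (_ * _ * _ * _); first by rewrite bin_sub.
  by rewrite exprnN; congr (k ^ _); lia.
(* The added term q = H - 1 is odd and at least 3, so its Bernoulli number is 0. *)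
rewrite [LHS](_ : _ = \sum_(0 <= q < H) \sum_(0 <= p < H - q) G q p); last first.
  rewrite [RHS](@big_cat_nat _ _ _ (H - 2).+1) /=; [|lia|lia].
  rewrite [X in _ = _ + X]big1_seq ?addr0; last first.
    move=> q /andP[_]; rewrite mem_index_iota => qH.
    by rewrite big1 // => p _; rewrite /G bernoulli_odd ?rmorph0 ?mul0r //; lia.
  by apply: eq_big_nat => q qH; rewrite inner //; lia.
pose D p q := k ^- p * a p * 'C(H, p)%:R * (ratr ('C(H - p, q)%:R * bernoulli q)).
have GD q p : (q < H)%N -> (p < H - q)%N -> G q p = D p q.
  move=> qH pH; rewrite /G /D rmorphM /= ratr_nat.
  have E : ('C(H, q) * 'C(H - q, p) = 'C(H, p) * 'C(H - p, q))%N.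
    have h1 : (q + p <= H)%N by lia.
    apply/eqP; rewrite -(eqn_pmul2r (_ : 0 < q`! * p`! * (H - q - p)`!)%N) ?muln_gt0 ?fact_gt0 //.
    have h2 : (p <= H - q)%N by lia.
    have h3 : (q <= H - p)%N by lia.
    have e1 := bin_fact (ltnW qH); have e2 := bin_fact h2.
    have e3 := bin_fact (_ : p <= H)%N; have e4 := bin_fact h3.
    rewrite (_ : H - p - q = H - q - p)%N in e4; last lia.
    apply/eqP; nia.
  have {}E := congr1 (fun x => x%:R : F) E; rewrite !natrM in E.
  transitivity (ratr (bernoulli q) * ('C(H, q)%:R * 'C(H - q, p)%:R) * k ^- p * a p).
    by ring.
  by rewrite E; ring.
rewrite [LHS](_ : _ = \sum_(0 <= p < H) \sum_(0 <= q < H - p) D p q); last first.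
  have W (f : nat -> F) n : (n <= H)%N ->
      \sum_(0 <= i < n) f i = \sum_(0 <= i < H) if (i < n)%N then f i else 0.
    by move=> nH; rewrite (big_nat_widen _ _ H) // big_mkcond.
  under eq_bigr do rewrite W ?leq_subr //.
  under [RHS]eq_bigr do rewrite W ?leq_subr //.
  rewrite exchange_big_nat; apply: eq_big_nat => p pH; apply: eq_big_nat => q qH.
  rewrite (_ : (q < H - p)%N = (p < H - q)%N); last lia.
  by case: ifP => // h; rewrite GD //; lia.
have Hp : (0 < H)%N by lia.
rewrite -[in LHS](prednK Hp) big_nat_recr //= big1_seq ?add0r; last first.
  move=> p /andP[_]; rewrite mem_index_iota => pH.
  rewrite /D -mulr_sumr -raddf_sum /=.
  rewrite prednK // (_ : H - p = (H - p.+1).+1)%N; last by lia.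
  by rewrite big_mkord bernoulli_rec ?rmorph0 ?mulr0 //; lia.
have -> : (H.-1.+1 - H.-1 = 1)%N by lia.
rewrite big_nat1 /D.
have -> : (H - H.-1 = 1)%N by lia.
have -> : 'C(H, H.-1) = H by rewrite -[in LHS](prednK Hp) binSn prednK.
by rewrite bin0 bernoulli0 mulr1 rmorph1; ring.
Qed.
End BernoulliInversion.

(** * Trigonometric expansions *)

Section UnitComplexNumbers.
Variable R : realType.
Implicit Types x y t : R.

Definition cis t : R[i] := cos t +i* sin t.

Lemma cis0 : cis 0 = 1. Proof. by rewrite /cis cos0 sin0. Qed.

Lemma cisD x y : cis (x + y) = cis x * cis y.
Proof.
by apply/eqP; rewrite /cis cosD sinD eq_complex /= eqxx addrC /=.
Qed.

Lemma cis_natmul n t : cis (n%:R * t) = cis t ^+ n.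
Proof.
elim: n => [|n IH]; first by rewrite mul0r cis0.
by rewrite exprS -IH -cisD -natr1; congr cis; ring.
Qed.

Lemma cis_neq0 t : cis t != 0.
Proof.
apply/eqP => h; have : cis (t + - t) = 0 by rewrite cisD h mul0r.
by rewrite subrr cis0 => /eqP; rewrite oner_eq0.
Qed.

Lemma cisN t : cis (- t) = (cis t)^-1.
Proof. by apply/esym/mulr1_eq; rewrite -cisD subrr cis0. Qed.

Lemma cis2pi : cis (2 * pi) = 1.
Proof.
by rewrite (_ : 2 * pi = pi *+ 2) ?mulr_natl // /cis cos2pi sin2pi.
Qed.

Lemma cis_neq1 t : 0 < t < 2 * pi -> cis t != 1.
Proof.
move=> /andP[t0 t2]; apply/eqP => -[c _].
have s0 : 0 < sin (t / 2) by apply: sin_gt0_pi; lra.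
have : cos (t / 2 + t / 2) = 1 by rewrite -splitr.
rewrite cosD -!expr2 cos2sin2 => h.
have : 0 < sin (t / 2) ^+ 2 by rewrite exprn_gt0.
lra.
Qed.

(** The order m divides n; if m < n, the m-th power has an angle strictly between 0 and 2 pi and
    cannot be 1. *)
Lemma cis_prim_root n : (0 < n)%N -> n.-primitive_root (cis (2 * pi / n%:R)).
Proof.
move=> n0; have nR : 0 < n%:R :> R by rewrite ltr0n.
have e1 : cis (2 * pi / n%:R) ^+ n = 1.
  by rewrite -cis_natmul mulrC divfK ?gt_eqF // cis2pi.
have [m mP mn] := prim_order_exists n0 e1.
have := dvdn_leq n0 mn; rewrite leq_eqVlt => /predU1P[e|mltn].
  by move: mP; rewrite e.
have m0 := prim_order_gt0 mP.
have := prim_expr_order mP; rewrite -cis_natmul => /eqP h.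
suff : cis (m%:R * (2 * pi / n%:R)) != 1 by rewrite h.
have p0 := pi_gt0 R.
apply: cis_neq1; rewrite mulrCA !mulr_gt0 ?invr_gt0 ?ltr0n //=.
by rewrite gtr_pMr ?mulr_gt0 // ltr_pdivrMr ?mul1r ?ltr_nat ?ltr0n ?m0 ?n0.
Qed.

Lemma conj_cis t : (cis t)^* = cis (- t).
Proof. by rewrite /cis cosN sinN. Qed.

Lemma cis_residue_neq1 k m : (0 < m < k)%N -> cis (2 * pi * m%:R / k%:R) != 1.
Proof.
move=> /andP[m0 mk]; have p0 := pi_gt0 R; apply: cis_neq1.
rewrite !mulr_gt0 ?invr_gt0 ?ltr0n //=; last lia.
by rewrite -mulrA gtr_pMr ?mulr_gt0 // ltr_pdivrMr ?mul1r ?ltr_nat // ltr0n; lia.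
Qed.

Lemma norm_imag_unit : `|(0 +i* 1 : R[i])| = 1.
Proof. by rewrite normc_def /= expr0n expr1n /= add0r sqrtr1. Qed.

End UnitComplexNumbers.

(** * Chebyshev expansions and powers of 1/(1 - e^(2iy)) *)

Section ChebyshevExpansions.

(** The Chebyshev polynomial of the second kind U_n at x/2. *)
Definition chebU (R : comNzRingType) n (x : R) : R :=
  \sum_(e < (n./2).+1) (-1) ^+ e * 'C(n - e, e)%:R * x ^+ (n - 2 * e).

Lemma chebU_widen (R : comNzRingType) n m (x : R) : (n./2 < m)%N ->
  chebU n x = \sum_(e < m) (-1) ^+ e * 'C(n - e, e)%:R * x ^+ (n - 2 * e).
Proof.
move=> nm; rewrite /chebU.
rewrite (big_ord_widen m (fun e => (-1) ^+ e * 'C(n - e, e)%:R * x ^+ (n - 2 * e))) //.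
rewrite big_mkcond; apply: eq_bigr => e _ /=; case: ltnP => // h.
by rewrite bin_small ?mulr0 ?mul0r //; lia.
Qed.

Lemma chebU_rec (R : comNzRingType) n (x : R) :
  chebU n.+2 x = x * chebU n.+1 x - chebU n x.
Proof.
rewrite (@chebU_widen _ n.+2 n.+3) ?(@chebU_widen _ n.+1 n.+3) ?(@chebU_widen _ n n.+2); try lia.
rewrite big_ord_recl [X in x * X]big_ord_recl /= !expr0 !bin0 !mul1r !subn0.
rewrite mulrDr -exprS -addrA mulr_sumr -sumrB; congr (_ + _).
apply: eq_bigr => e _; rewrite /bump /= !add1n exprS mulN1r.
have -> : (n.+2 - e.+1 = n.+1 - e)%N by lia.
have -> : (n.+1 - e.+1 = n - e)%N by lia.
have -> : (n.+1 - 2 * e.+1 = n - (2 * e).+1)%N by lia.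
have -> : (n.+2 - 2 * e.+1 = n - 2 * e)%N by lia.
(* Where the natural subtractions in the exponents truncate, the binomials vanish. *)
have [h|h] := leqP (2 * e)%N n; last first.
  rewrite !(bin_small (_ : n.+1 - e < e.+1)%N) ?(bin_small (_ : n - e < e.+1)%N); try lia.
  rewrite (bin_small (_ : n - e < e)%N); last by lia.
  by ring.
rewrite (_ : n.+1 - e = (n - e).+1)%N; last by lia.
rewrite binS natrD.
have [h'|h'] := leqP (2 * e).+1 n.
  by rewrite (_ : n - 2 * e = (n - (2 * e).+1).+1)%N ?exprS; [ring|lia].
by rewrite (bin_small (_ : n - e < e.+1)%N); [ring|lia].
Qed.

Variable R : realType.
Implicit Types y : R.

Lemma sin_chebU n y : sin (n.+1%:R * y) = sin y * chebU n (2 * cos y).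
Proof.
suff [] : sin (n.+1%:R * y) = sin y * chebU n (2 * cos y) /\
  sin (n.+2%:R * y) = sin y * chebU n.+1 (2 * cos y) by [].
elim: n => [|n [IH1 IH2]].
  rewrite /chebU !big_ord1 /= !expr0 !bin0 expr1 !mulr1 !mul1r.
  by split=> //; rewrite (_ : 2 * y = y + y) ?sinD; ring.
split=> //; rewrite chebU_rec mulrBr -IH1 mulrCA -IH2.
have -> : n.+3%:R * y = n.+2%:R * y + y by rewrite -natr1; ring.
have -> : n.+1%:R * y = n.+2%:R * y - y by rewrite -[n.+2%:R]natr1; ring.
rewrite sinD sinB; ring.
Qed.

(** The right side is the coefficient in U_a - U_(a-2) = 2 T_a; the sign of the second term is
    absorbed by its index shift. *)
Lemma chebT_coef a c : (c <= a./2)%N -> (1 < a)%N ->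
  (a * (a - c - 1)`!)%:R / (c`! * (a - 2 * c)`!)%:R =
  'C(a - c, c)%:R + (if c is c'.+1 then 'C(a - 2 - c', c')%:R else 0) :> R.
Proof.
move=> ca a1.
have nz : (c`! * (a - 2 * c)`!)%:R != 0 :> R by rewrite pnatr_eq0 -lt0n muln_gt0 !fact_gt0.
apply: (mulIf nz); rewrite divfK // mulrDl -!natrM.
have h1 := bin_fact (_ : c <= a - c)%N.
rewrite (_ : a - c - c = a - 2 * c)%N in h1; last lia.
rewrite h1; last lia.
case: c => [|c] in ca nz h1 *.
  by rewrite mul0r addr0 !subn0 subn1 -[in RHS](prednK (_ : 0 < a)%N) ?factS ?prednK //; lia.
have h2 := bin_fact (_ : c <= a - 2 - c)%N.
rewrite (_ : a - 2 - c - c = a - 2 * c.+1)%N in h2; last lia.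
rewrite -natrM -natrD; congr (_%:R).
rewrite factS (_ : 'C(a - 2 - c, c) * (c.+1 * c`! * (a - 2 * c.+1)`!) =
    c.+1 * (a - 2 - c)`!)%N; last first.
  by rewrite -h2; [ring|lia].
rewrite (_ : a - c.+1 - 1 = a - 2 - c)%N; last lia.
rewrite (_ : a - c.+1 = (a - 2 - c).+1)%N; last lia.
by rewrite factS -mulnDl; congr (_ * _)%N; lia.
Qed.

Lemma cos_chebT a y : (1 < a)%N -> sin y != 0 ->
  2 * cos (a%:R * y) = \sum_(c < (a./2).+1)
    (-1) ^+ c * ((a * (a - c - 1)`!)%:R / (c`! * (a - 2 * c)`!)%:R) * (2 * cos y) ^+ (a - 2 * c).
Proof.
case: a => [|[|a]] // _ sy.
transitivity (chebU a.+2 (2 * cos y) - chebU a (2 * cos y)).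
  apply: (mulfI sy); rewrite mulrBr -!sin_chebU.
  have -> : a.+3%:R * y = a.+2%:R * y + y by rewrite -[a.+3%:R]natr1; ring.
  have -> : a.+1%:R * y = a.+2%:R * y - y by rewrite -[a.+2%:R]natr1; ring.
  by rewrite sinD sinB; ring.
rewrite /chebU /= big_ord_recl [RHS]big_ord_recl -addrA; congr (_ + _).
  by rewrite (@chebT_coef a.+2 0) ?addr0.
rewrite -sumrB; apply: eq_bigr => c _; rewrite /= /bump /= !add1n.
rewrite chebT_coef //.
rewrite [(-1) ^+ c.+1]exprS (_ : a.+2 - 2 - c = a - c)%N; last by lia.
rewrite (_ : a.+2 - 2 * c.+1 = a - 2 * c)%N; last by lia.
by ring.
Qed.

(* [(-1) ^+ a] times the real part of [(1 - cis (2 * y))^-1 ^+ a]. *)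
Definition recip_pow_re a y : R :=
  if odd a then (-1) ^+ (a.+1)./2 * sin (a%:R * y) / (2 * sin y) ^+ a
  else (-1) ^+ a./2 * cos (a%:R * y) / (2 * sin y) ^+ a.

Lemma cos_even_pow y m : cos y ^+ (2 * m) =
  \sum_(d < m.+1) (-1) ^+ d * 'C(m, d)%:R * sin y ^+ (2 * d).
Proof.
rewrite exprM cos2sin2 exprDn; apply: eq_bigr => d _.
by rewrite expr1n mul1r [in LHS]exprNn -exprM -[_ *+ _]mulr_natl; ring.
Qed.

(** The inner sums of [Sigma2'] for one residue: cos(ay) is expanded by [cos_chebT], then its even
    powers of cos y by cos^2 = 1 - sin^2. *)
Lemma recip_pow_re_even a y : (1 < a)%N -> ~~ odd a -> sin y != 0 ->
  \sum_(0 <= c < (a./2).+1) \sum_(0 <= d < ((a - 2 * c)./2).+1)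
    (-1) ^+ (c + d + a./2)
    * ((a * (a - c - 1)`!)%:R / (2 ^ (2 * c + 1) * c`! * (a - 2 * c)`!)%:R)
    * 'C((a - 2 * c)./2, d)%:R * (1 / sin y ^+ (a - 2 * d)) =
  recip_pow_re a y.
Proof.
move=> a1 ea sy; rewrite /recip_pow_re (negbTE ea).
have nz2 : 2 != 0 :> R by rewrite pnatr_eq0.
have -> : cos (a%:R * y) = 2^-1 * (2 * cos (a%:R * y)) by rewrite mulKf.
rewrite cos_chebT // !big_mkord !mulr_sumr mulr_suml.
apply: eq_bigr => c _; have ca : (2 * c <= a)%N by move: (ltn_ord c); lia.
rewrite big_mkord exprMn.
have E : (a - 2 * c = 2 * (a - 2 * c)./2)%N by lia.
rewrite [in cos y ^+ _]E cos_even_pow !mulr_sumr mulr_suml; apply: eq_bigr => d _.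
have da : (2 * d <= a)%N by move: (ltn_ord d); lia.
have -> : sin y ^+ (2 * d) = sin y ^+ a / sin y ^+ (a - 2 * d).
  by rewrite -[in sin y ^+ a](subnK da) exprD mulrAC mulfV ?mul1r // expf_neq0.
have -> : 2 ^+ (a - 2 * c) = 2 ^+ a / 2 ^+ (2 * c) :> R.
  by rewrite -[in 2 ^+ a](subnK ca) exprD mulfK // expf_neq0.
rewrite !natrM natrX !exprD expr1 exprMn.
by field; rewrite !expf_neq0 //= !pnatr_eq0 -!lt0n !fact_gt0.
Qed.

(** As in the even case, with sin(ay) = sin y U_(a-1)(cos y); the extra sin y lowers the exponent by
    one. *)
Lemma recip_pow_re_odd a y : odd a -> sin y != 0 ->
  \sum_(0 <= e < ((a - 1)./2).+1) \sum_(0 <= f < ((a - 2 * e - 1)./2).+1)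
    (-1) ^+ (e + f + (a + 1)./2)
    * ((a - e - 1)`!%:R / (2 ^ (2 * e + 1) * e`! * (a - 2 * e - 1)`!)%:R)
    * 'C((a - 2 * e - 1)./2, f)%:R * (1 / sin y ^+ (a - 2 * f - 1)) =
  recip_pow_re a y.
Proof.
move=> oa sy; rewrite /recip_pow_re oa addn1.
have nz2 : 2 != 0 :> R by rewrite pnatr_eq0.
case: a oa => // a; rewrite /= => ea.
rewrite sin_chebU /chebU subn1 /= big_mkord !mulr_sumr mulr_suml.
apply: eq_bigr => e _.
have ce : (2 * e <= a)%N by move: (ltn_ord e); lia.
have -> : (a.+1 - 2 * e - 1 = a - 2 * e)%N by lia.
have -> : (a.+1 - e - 1 = a - e)%N by lia.
have h1 := bin_fact (_ : e <= a - e)%N.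
rewrite (_ : a - e - e = a - 2 * e)%N in h1; last lia.
rewrite -h1; last lia.
rewrite big_mkord exprMn.
have E : (a - 2 * e = 2 * (a - 2 * e)./2)%N by lia.
rewrite [in cos y ^+ _]E cos_even_pow !mulr_sumr mulr_suml; apply: eq_bigr => f _.
have df : (2 * f <= a)%N by move: (ltn_ord f); lia.
have -> : (a.+1 - 2 * f - 1 = a - 2 * f)%N by lia.
have -> : sin y ^+ (2 * f) = sin y ^+ a / sin y ^+ (a - 2 * f).
  by rewrite -[in sin y ^+ a](subnK df) exprD mulrAC mulfV ?mul1r // expf_neq0.
have -> : 2 ^+ (a - 2 * e) = 2 ^+ a / 2 ^+ (2 * e) :> R.
  by rewrite -[in 2 ^+ a](subnK ce) exprD mulfK // expf_neq0.
rewrite !natrM natrX !exprD expr1 exprMn !exprS.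
by field; rewrite !expf_neq0 //= ?sy ?nz2 //= !pnatr_eq0 -!lt0n !fact_gt0.
Qed.

(** This is 1 - e^(2iy) = -2i sin y e^(iy), inverted. *)
Lemma recip_one_sub_cis y : sin y != 0 ->
  (1 - cis (2 * y))^-1 = ((2 * sin y)^-1)%:C * ((0 +i* 1) * cis (- y)).
Proof.
move=> sy; apply: mulr1_eq; rewrite /cis cosN sinN (_ : 2 * y = y + y); last by ring.
have c2 : cos y * cos y = 1 - sin y * sin y by rewrite -!expr2 cos2sin2.
apply/eqP; rewrite cosD sinD eq_complex /= c2; apply/andP; split; apply/eqP.
  transitivity ((sin y * sin y + cos y * cos y) : R); last by rewrite c2; ring.
  by field.
by field.
Qed.

Lemma Re_recip_pow a y : sin y != 0 ->
  complex.Re ((1 - cis (2 * y))^-1 ^+ a) = (-1) ^+ a * recip_pow_re a y.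
Proof.
move=> sy; rewrite recip_one_sub_cis //.
rewrite !exprMn -cis_natmul -rmorphXn mulrN /cis cosN sinN /recip_pow_re.
have i2 : (0 +i* 1 : R[i]) ^+ 2 = (- 1)%:C.
  by apply/eqP; rewrite expr2 eq_complex /=; apply/andP; split; apply/eqP; ring.
have ieven m : (0 +i* 1 : R[i]) ^+ (2 * m) = ((-1) ^+ m)%:C.
  by rewrite exprM i2 -rmorphXn.
case: ifP => oa.
  have -> : (0 +i* 1 : R[i]) ^+ a = ((-1) ^+ a./2)%:C * (0 +i* 1).
    by rewrite -ieven -exprSr; congr (_ ^+ _); lia.
  rewrite /= (_ : uphalf a = (a./2).+1) ?exprS; last by rewrite uphalf_half oa.
  rewrite -[(-1) ^+ a]signr_odd oa exprVn expr1; ring.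
have -> : (0 +i* 1 : R[i]) ^+ a = ((-1) ^+ a./2)%:C.
  by rewrite -ieven; congr (_ ^+ _); lia.
by rewrite /= -[(-1) ^+ a]signr_odd oa exprVn expr0; ring.
Qed.

End ChebyshevExpansions.

(** * Orthogonality of Dirichlet characters *)

Section DirichletOrthogonality.
Variable R : realType.
Local Notation C := R[i].

(* If every irreducible character were 1 at g, the regular character, which is
   their sum, would take the same value at g and at 1. *)
Lemma abelian_char_separation (gT : finGroupType) (g : gT) :
  abelian [set: gT]%SET -> g != 1%g ->
  exists f : gT -> C,
    [/\ forall x y, f (x * y)%g = f x * f y, f 1%g = 1 & f g != 1].
Proof.
move=> cGG g1; pose G := [set: gT]%G.
have Gx x : x \in 'Z(G)%g by rewrite (center_idP _) ?inE.
have splitG : group_splitting_field C G.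
  exact: primitive_root_splitting_abelian (cis_prim_root R (cardG_gt0 G)) cGG.
have charG : [pchar C]^'.-group%g G.
  by apply/pgroupP => p _ _; rewrite inE /= pchar_num.
pose sG : irrType C G := DecSocleType (regular_repr C G).
have [i gi|all1] := pickP (fun i : sG => irr_mode i g != 1).
  by exists (irr_mode i); split=> [x y||//]; [exact: irr_modeM|exact: irr_mode1].
have trE x : (forall i : sG, irr_mode i x = 1) ->
    \tr (regular_repr C G x) = \sum_(i : sG) 1.
  move=> x1; rewrite (mxtrace_regular_pchar sG) ?inE //; apply: eq_bigr => i _.
  rewrite irr_degree_abelian // irr_center_scalar // x1 mxtrace_scalar.
  by rewrite -/(irr_degree i) irr_degree_abelian.
have := trE g (fun i => eqP (negbFE (all1 i))).
rewrite -(trE 1%g) => [|i]; last exact: irr_mode1.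
(* The trace at 1 is the group order; at [g] it is 0, because translation by [g] fixes no
   element. *)
rewrite repr_mx1 mxtrace1 [\tr _]big1 => [/eqP|i _].
  by rewrite eq_sym pnatr_eq0 gtn_eqF ?cardG_gt0.
rewrite 2!mxE /= -(inj_eq enum_val_inj) gring_indexK ?groupM ?enum_valP ?inE //.
by rewrite eq_mulVg1 mulKg (negbTE g1).
Qed.

(** A separating character of the unit group of Z/k, extended by 0 to the non-units. *)
Lemma dirichlet_char_separation k (m : int) : (1 < k)%N -> coprimez m k%:Z ->
  (m %% k)%Z != 1 -> exists2 chi : int -> C, is_dirichlet_char k chi & chi m != 1.
Proof.
move=> k1 mk m1.
have kR : (k%:Z)%:~R = 0 :> 'Z_k by rewrite -pmulrn pchar_Zp.
have intE (n : int) : n%:~R = (`|(n %% k)%Z|)%:R :> 'Z_k.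
  rewrite [in LHS](divz_eq n k) rmorphD rmorphM /= kR mulr0 add0r.
  by rewrite -[in LHS](gez0_abs (modz_ge0 _ _)) //; lia.
have unitE (n : int) : (n%:~R : 'Z_k) \is a GRing.unit = coprimez n k.
  rewrite intE unitZpE // coprime_sym coprimezE /=.
  have -> : coprime `|(n %% k)%Z| k = (gcdz (n %% k)%Z k == 1) by [].
  by rewrite gcdz_modl.
have mU : (m%:~R : 'Z_k) \is a GRing.unit by rewrite unitE.
pose g : {unit 'Z_k} := FinRing.unit 'Z_k mU.
have g1 : g != 1%g.
  apply: contraNneq m1 => /(congr1 val) /= h.
  have : m%:~R = 1%:R :> 'Z_k by rewrite -[LHS]/(val g) /= h.
  rewrite intE => /(congr1 (@nat_of_ord _)); rewrite !val_Zp_nat // !modn_small //; last first.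
    by rewrite -ltz_nat gez0_abs ?ltz_pmod ?modz_ge0 //; lia.
  by move=> e; rewrite -(gez0_abs (modz_ge0 m _)) ?e //; lia.
have [f [fM f1 fg]] := abelian_char_separation (units_Zp_abelian k) g1.
pose chi (n : int) : C := oapp f 0 (insub (n%:~R : 'Z_k)).
have chiE n (nU : (n%:~R : 'Z_k) \is a GRing.unit) : chi n = f (FinRing.unit 'Z_k nU).
  by rewrite /chi insubT.
have chi0 n : ~~ coprimez n k -> chi n = 0.
  by rewrite -unitE => nU; rewrite /chi insubN.
exists chi; last by rewrite chiE.
split=> [a b|n|n].
- have [ca|ca] := boolP (coprimez a k); last first.
    by rewrite [chi a]chi0 // mul0r chi0 // coprimezMl (negbTE ca).
  have [cb|cb] := boolP (coprimez b k); last first.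
    by rewrite [chi b]chi0 // mulr0 chi0 // coprimezMl (negbTE cb) andbF.
  have aU : (a%:~R : 'Z_k) \is a GRing.unit by rewrite unitE.
  have bU : (b%:~R : 'Z_k) \is a GRing.unit by rewrite unitE.
  have abU : ((a * b)%:~R : 'Z_k) \is a GRing.unit by rewrite unitE coprimezMl ca.
  rewrite !chiE -fM; congr f; apply: val_inj; rewrite /= rmorphM //.
- by rewrite /chi rmorphD /= kR addr0.
have [cn|ncn] := boolP (coprimez n k); last by rewrite chi0 ?eqxx.
have nU : (n%:~R : 'Z_k) \is a GRing.unit by rewrite unitE.
rewrite chiE; apply/eqP => h; move/eqP: f1.
by rewrite -(mulgV (FinRing.unit 'Z_k nU)) fM h mul0r eq_sym oner_eq0.
Qed.

(** * Orthogonality relations *)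

Section CharacterSums.
Variables (k : nat).
Hypothesis k1 : (1 < k)%N.
Local Notation D := [set chi : int -> C | is_dirichlet_char k chi].

Lemma finite_characters : finite_set D. Proof. exact/finite_dirichlet_chars/ltnW. Qed.

Lemma dirichlet_char_mul chi psi : D chi -> D psi -> D (chi \* psi).
Proof.
move=> [cM cD c0] [pM pD p0]; split=> [m n|n|n] /=.
- by rewrite cM pM; ring.
- by rewrite cD pD.
by rewrite mulf_eq0 negb_or c0 p0 andbb.
Qed.

Lemma dirichlet_char_inv chi : D chi -> D (fun n => (chi n)^-1).
Proof.
move=> [cM cD c0]; split=> [m n|n|n]; last by rewrite invr_eq0 c0.
  by rewrite cM invfM.
by rewrite cD.
Qed.

Lemma dirichlet_char_bij chi : D chi -> set_bij D D (fun psi => chi \* psi).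
Proof.
move=> cD; have [cM cP c0] := cD.
(* Where [chi] is 0 so is [psi]: both are supported on the integers prime to [k]. *)
have K psi n : D psi -> chi n * ((chi n)^-1 * psi n) = psi n.
  move=> [_ _ p0]; have [/eqP c|c] := boolP (chi n == 0); last by rewrite mulVKf.
  by rewrite c mul0r; apply/esym/eqP/negPn; rewrite p0 -c0 c eqxx.
split=> [psi Dp|x y /set_mem Dx /set_mem Dy e|psi Dp].
- exact: dirichlet_char_mul.
- apply/funext => n; rewrite -(K x n Dx) -(K y n Dy) mulrCA [RHS]mulrCA.
  by congr (_ * _); apply: (congr1 (fun f => f n) e).
- exists ((fun n => (chi n)^-1) \* psi); last by apply/funext => n; apply: K.
  exact: dirichlet_char_mul (dirichlet_char_inv cD) Dp.
Qed.

(** Multiplication by a character with chi(m) different from 1 permutes the characters and scales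
    the sum by chi(m). *)
Lemma sum_dirichlet_chars_eq0 m : coprimez m k -> (m %% k)%Z != 1 ->
  \sum_(chi \in D) chi m = 0.
Proof.
move=> mk m1; have [chi Dc cm] := dirichlet_char_separation k1 mk m1.
have e : \sum_(psi \in D) psi m = chi m * \sum_(psi \in D) psi m.
  by rewrite [LHS](reindex_fsbig _ _ _ _ (dirichlet_char_bij Dc)) mulr_fsumr.
apply/eqP; move/eqP: e; rewrite -subr_eq0 -{1}[X in X - _]mul1r -mulrBl mulf_eq0.
by rewrite subr_eq0 eq_sym (negbTE cm).
Qed.

Lemma dirichlet_char_coprime0 chi n : D chi -> ~~ coprimez n k -> chi n = 0.
Proof. by move=> [_ _ c0]; rewrite -c0 negbK => /eqP. Qed.

Lemma sum_residues chi : D chi -> (exists2 n, coprimez n k & chi n != 1) ->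
  \sum_(m < k) chi m%:Z = 0.
Proof.
move=> Dc [n nk cn]; have [cM cP c0] := Dc.
pose n' := `|(n %% k)%Z|%N.
have n'E : n'%:Z = (n %% k)%Z by rewrite /n' gez0_abs ?modz_ge0 //; lia.
have cn' : chi n'%:Z = chi n by rewrite n'E (dirichlet_char_mod _ Dc).
have nk' : coprime n' k.
  have -> : coprime n' k = coprimez n'%:Z k by [].
  by rewrite -c0 cn' c0.
have k0 : (0 < k)%N by lia.
pose h (m : 'I_k) := Ordinal (ltn_pmod (n' * m) k0).
have hI : injective h.
  move=> x y /(congr1 val) /= /eqP.
  wlog xy : x y / (x <= y)%N => [W|].
    by case: (leqP x y) => [/W//|/ltnW/W W' e]; apply/esym/W'; rewrite eq_sym.
  rewrite eq_sym eqn_mod_dvd ?leq_mul2l ?xy ?orbT // -mulnBr Gauss_dvdr; last first.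
    by rewrite coprime_sym.
  move=> d; apply/val_inj/eqP; rewrite /= eqn_leq xy /= -subn_eq0.
  apply: contraTT d => d; rewrite gtnNdvd // ?lt0n //.
  exact: leq_ltn_trans (leq_subr _ _) (ltn_ord y).
have e : \sum_(m < k) chi m%:Z = chi n * \sum_(m < k) chi m%:Z.
  rewrite [LHS](reindex_inj hI) mulr_sumr; apply: eq_bigr => m _ /=.
  by rewrite -cn' -cM -PoszM -(dirichlet_char_mod (_ * _)%N%:Z Dc) modz_nat.
apply/eqP; move/eqP: e; rewrite -subr_eq0 -{1}[X in X - _]mul1r -mulrBl mulf_eq0.
by rewrite subr_eq0 eq_sym (negbTE cn).
Qed.

Definition principal_char (n : int) : C := (coprimez n k)%:R.

Lemma principal_charP : D principal_char.
Proof.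
split=> [m n|n|n]; rewrite /principal_char.
- by rewrite coprimezMl -natrM mulnb.
- by rewrite /coprimez -gcdz_modl modzDr gcdz_modl.
by case: coprimez; rewrite ?oner_eq0 ?eqxx.
Qed.

(** The sum of chi(m) over all m and chi is computed twice: for fixed m only m = 1 survives, for
    fixed chi only the principal character. *)
Lemma count_dirichlet_chars : \sum_(chi \in D) (1 : C) = (totient k)%:R.
Proof.
have k0 : (0 < k)%N by lia.
transitivity (\sum_(m < k) \sum_(chi \in D) chi m%:Z).
  rewrite (bigD1 (Ordinal k1)) //= [X in _ + X]big1 ?addr0 => [|m m1].
    by apply: eq_fsbigr => chi /set_mem Dc; rewrite (dirichlet_char1 Dc).
  have [mk|mk] := boolP (coprimez m k).
    apply: sum_dirichlet_chars_eq0 => //; apply: contraNneq m1 => h.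
    apply/eqP/val_inj; rewrite /= -(modn_small (ltn_ord m)).
    by apply/eqP; rewrite -eqz_nat -modz_nat h.
  by rewrite fsbig1 // => chi Dc; apply: dirichlet_char_coprime0.
transitivity (\sum_(chi \in D) \sum_(m < k) chi m%:Z).
  rewrite fsbig_finite /=; last exact: finite_characters.
  rewrite exchange_big; apply: eq_bigr => m _; rewrite fsbig_finite //; exact: finite_characters.
rewrite (fsbigD1 principal_char) //=; [|exact: finite_characters|exact: principal_charP].
rewrite [X in _ + X]fsbig1 ?addr0 => [|chi [Dc cp]].
  rewrite totient_count_coprime big_mkord natr_sum.
  by apply: eq_bigr => m _; rewrite coprime_sym.
apply: sum_residues => //; apply: contrapT => h; apply: cp; apply/funext => n.
rewrite /principal_char; have [nk|nk] := boolP (coprimez n k); last first.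
  exact: dirichlet_char_coprime0.
by apply/eqP/negPn/negP => cn; apply: h; exists n.
Qed.

Lemma sum_dirichlet_chars m :
  \sum_(chi \in D) chi m = (totient k * ((m %% k)%Z == 1))%:R.
Proof.
have [e|m1] := eqVneq (m %% k)%Z 1.
  rewrite muln1 -count_dirichlet_chars; apply: eq_fsbigr => chi /set_mem Dc.
  by rewrite -(dirichlet_char_mod _ Dc) e (dirichlet_char1 Dc).
rewrite muln0; have [mk|mk] := boolP (coprimez m k).
  exact: sum_dirichlet_chars_eq0.
by rewrite fsbig1 // => chi Dc; apply: dirichlet_char_coprime0.
Qed.

Lemma sum_even_dirichlet_chars m :
  \sum_(chi \in even_dirichlet_chars R k) chi m =
  (totient k)%:R / 2 * (((m %% k)%Z == 1) + ((- m %% k)%Z == 1))%:R.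
Proof.
have two0 : 2 != 0 :> C by rewrite pnatr_eq0.
(* The mean of chi(m) and chi(-m) is chi(m) for even chi and 0 for the others, so the sum extends to
   all characters. *)
transitivity (\sum_(chi \in D) (2^-1 * (chi m + chi (- m)))).
  transitivity (\sum_(chi \in even_dirichlet_chars R k) (2^-1 * (chi m + chi (- m)))).
    apply: eq_fsbigr => chi /set_mem [Dc ce]; have [cM _ _] := Dc.
    by rewrite -mulN1r cM ce mul1r; field.
  apply: fsbig_widen => [chi []//|chi [Dc cN]]; have [cM _ _] := Dc.
  have : chi (- 1) ^+ 2 = 1 by rewrite expr2 -cM mulrNN mulr1 (dirichlet_char1 Dc).
  move/eqP; rewrite sqrf_eq1 => /orP[/eqP h|/eqP h]; first by case: cN.
  by rewrite /preimage /= -[- m]mulN1r cM h mulN1r subrr mulr0.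
rewrite -mulr_fsumr fsbig_split ?sum_dirichlet_chars; [|exact: finite_characters].
by rewrite !natrM natrD /=; ring.
Qed.

Lemma norm_dirichlet_char chi m : D chi -> chi m != 0 -> `|chi m| = 1.
Proof.
move=> Dc; pose m' := `|(m %% k)%Z|%N.
have <- : chi m'%:Z = chi m.
  by rewrite /m' gez0_abs ?modz_ge0 ?(dirichlet_char_mod _ Dc) //; lia.
move=> c0; have := dirichlet_char_root m' Dc.
rewrite rootM !rootE !hornerE /= (negbTE c0) /= subr_eq0 => /eqP/(congr1 Num.norm).
rewrite normrX normr1 => /eqP; rewrite pexpr_eq1 ?normr_ge0 //; last first.
  by rewrite totient_gt0; lia.
by move/eqP.
Qed.

(** By Bezout [n] has an inverse [u] mod [k], and chi(n)^-1 = chi(u). *)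
Lemma sum_even_dirichlet_charsV m n : coprimez n k ->
  \sum_(chi \in even_dirichlet_chars R k) chi m * (chi n)^-1 =
  (totient k)%:R / 2 * ((m == n %[mod k])%Z + (m == - n %[mod k])%Z)%:R.
Proof.
move=> /coprimezP[[u v] /= uv].
transitivity (\sum_(chi \in even_dirichlet_chars R k) chi (m * u)).
  apply: eq_fsbigr => chi /set_mem [Dc _]; have [cM _ _] := Dc.
  rewrite cM; congr (_ * _); apply: mulr1_eq; rewrite -cM.
  rewrite -(dirichlet_char_mod _ Dc) (_ : n * u = 1 - v * k); last by rewrite -uv; ring.
  by rewrite -mulNr addrC modzMDl (dirichlet_char_mod _ Dc) (dirichlet_char1 Dc).
have k1z : (1 %% k)%Z = 1 by rewrite modz_small //; lia.
have kvk : (k %| v * k)%Z by apply: dvdz_mull.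
have E s : ((s * u %% k)%Z == 1) = (s == n %[mod k])%Z.
  rewrite -{1}k1z !eqz_mod_dvd; apply/idP/idP => h.
    have -> : s - n = n * (s * u - 1) + s * (v * k).
      by rewrite (_ : v * k = 1 - u * n); [ring|rewrite -uv; ring].
    by rewrite rpredD // dvdz_mull.
  have -> : s * u - 1 = (s - n) * u - v * k.
    by rewrite (_ : v * k = 1 - u * n); [ring|rewrite -uv; ring].
  by rewrite rpredB // dvdz_mulr.
rewrite sum_even_dirichlet_chars E -mulNr E; congr (_ * (_ + nat_of_bool _)%:R).
by rewrite !eqz_mod_dvd -rpredN opprB opprK addrC opprK.
Qed.

End CharacterSums.

End DirichletOrthogonality.

(** * L-values of even characters *)

Section SmallAngleAsymptotics.
Variable R : realType.
Local Notation C := R[i].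

Lemma monotone_from_0 (f f' : R -> R) (b : R) :
  (forall x : R, is_derive x (1 : R) f (f' x)) -> (forall x, 0 <= x <= b -> 0 <= f' x) ->
  forall x, 0 <= x <= b -> f 0 <= f x.
Proof.
move=> df f'0 x /andP[x0 xb].
apply: (@ger0_derive1_ndecr R f 0 b) => //.
- by move=> y; rewrite in_itv /= => /andP[y0 yb]; rewrite derive1E derive_val f'0 ?ltW.
- apply: continuous_subspaceT => y; apply: differentiable_continuous.
  exact/derivable1_diffP.
Qed.

Lemma sin_le_id (y : R) : 0 <= y -> sin y <= y.
Proof.
move=> y0; rewrite -subr_ge0.
have := @monotone_from_0 (fun x => x - sin x) (fun x => 1 - cos x) y.
rewrite /= sin0 subr0; apply; last by rewrite y0 lexx.
by move=> x _; rewrite subr_ge0 cos_le1.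
Qed.

Lemma mul_cos_le_sin (y : R) : 0 <= y <= pi -> y * cos y <= sin y.
Proof.
move=> yp; rewrite -subr_ge0.
have := @monotone_from_0 (fun x => sin x - x * cos x) (fun x => x * sin x) pi.
rewrite /= sin0 mul0r subr0; apply=> //; last first.
  by move=> x xp; rewrite mulr_ge0 ?sin_ge0_pi //; case/andP: xp.
by move=> x; apply: is_derive_eq; rewrite /GRing.scale /=; ring.
Qed.

(** With y = t/2 the difference is y + i (y cot y - 1), and both parts are at most y = t/2 in
    absolute value. *)
Lemma norm_recip_cis (t : R) : 0 < t <= pi ->
  `|t%:C / (1 - cis t) - (0 +i* 1)| <= t%:C.
Proof.
move=> /andP[t0 tpi]; pose y := t / 2.
have y0 : 0 < y by rewrite divr_gt0.
have ypi2 : y <= pi / 2 by rewrite ler_pM2r ?invr_gt0.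
have p0 := pi_gt0 R.
have s0 : 0 < sin y by apply: sin_gt0_pi; lra.
have sy := sin_le_id (ltW y0).
have cy : y * cos y <= sin y by apply: mul_cos_le_sin; lra.
have c0 : 0 <= cos y by apply: cos_ge0_pihalf; lra.
have cs : sin y <= y * cos y + y * sin y.
  have h : 1 <= cos y + sin y.
    rewrite leNgt; apply/negP => h.
    have := cos2Dsin2 y; have := mulr_ge0 c0 (ltW s0); nra.
  nra.
have tE : t = 2 * y by rewrite /y mulrC divfK.
have -> : t%:C / (1 - cis t) - (0 +i* 1) = y +i* (y * cos y / sin y - 1).
  have -> : (1 - cis t)^-1 = ((2 * sin y)^-1)%:C * ((0 +i* 1) * cis (- y)).
    by rewrite tE recip_one_sub_cis ?gt_eqF.
  apply/eqP; rewrite /cis cosN sinN tE eq_complex /=; apply/andP; split; apply/eqP.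
    by field; rewrite gt_eqF.
  by field; rewrite gt_eqF.
rewrite normc_def /= lecR.
have : `|y * cos y / sin y - 1| <= y.
  rewrite ler_norml; apply/andP; split.
    by rewrite lerBrDr lter_pdivlMr //; nra.
  by rewrite lerBlDr ler_pdivrMr //; nra.
rewrite ler_norml => /andP[h1 h2].
rewrite -[leRHS](gtr0_norm t0) -sqrtr_sqr ler_sqrt ?sqr_ge0 //.
by set w := _ - 1 in h1 h2 *; rewrite tE; nra.
Qed.

(* A quantity depending on a small angle [t] and on an approximation [v] of [w]
   with error at most [t]. *)
Definition angle_lipschitz (B w : C) (g : C -> C -> C) (l : C) :=
  exists2 K : C, 0 <= K & forall t v, 0 <= t <= B -> `|v - w| <= t ->
    `|g t v - l| <= K * t.

Lemma angle_lipschitz_const B w c : angle_lipschitz B w (fun _ _ => c) c.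
Proof. by exists 0 => // t v _ _; rewrite subrr normr0 mul0r. Qed.

Lemma angle_lipschitz_t B w : angle_lipschitz B w (fun t _ => t) 0.
Proof. by exists 1 => // t v /andP[t0 _] _; rewrite subr0 mul1r ger0_norm. Qed.

Lemma angle_lipschitz_v B w : angle_lipschitz B w (fun _ v => v) w.
Proof. by exists 1 => // t v _ h; rewrite mul1r. Qed.

Lemma angle_lipschitzD B w g1 g2 l1 l2 : angle_lipschitz B w g1 l1 ->
  angle_lipschitz B w g2 l2 ->
  angle_lipschitz B w (fun t v => g1 t v + g2 t v) (l1 + l2).
Proof.
move=> [K1 K10 h1] [K2 K20 h2]; exists (K1 + K2); first exact: addr_ge0.
move=> t v tB vw; rewrite opprD addrACA mulrDl.
by apply: le_trans (ler_normD _ _) _; rewrite lerD ?h1 ?h2.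
Qed.

Lemma angle_lipschitzM B w g1 g2 l1 l2 : 0 <= B -> angle_lipschitz B w g1 l1 ->
  angle_lipschitz B w g2 l2 ->
  angle_lipschitz B w (fun t v => g1 t v * g2 t v) (l1 * l2).
Proof.
move=> B0 [K1 K10 h1] [K2 K20 h2].
exists (K1 * (K2 * B + `|l2|) + `|l1| * K2).
  by rewrite !(addr_ge0, mulr_ge0).
move=> t v tB vw; have [t0 tB'] := andP tB.
have -> : g1 t v * g2 t v - l1 * l2 =
    (g1 t v - l1) * g2 t v + l1 * (g2 t v - l2) by ring.
apply: le_trans (ler_normD _ _) _; rewrite !normrM mulrDl; apply: lerD.
  rewrite mulrAC ler_pM ?h1 //.
  rewrite -[g2 t v](subrK l2); apply: le_trans (ler_normD _ _) _.
  by rewrite lerD2r (le_trans (h2 _ _ tB vw)) // ler_wpM2l.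
by rewrite -mulrA ler_wpM2l ?h2.
Qed.

Lemma angle_lipschitzX B w g l n : 0 <= B -> angle_lipschitz B w g l ->
  angle_lipschitz B w (fun t v => g t v ^+ n) (l ^+ n).
Proof.
move=> B0 gl; elim: n => [|n IH]; first exact: angle_lipschitz_const.
rewrite exprS; have := angle_lipschitzM B0 gl IH.
by case=> K K0 h; exists K => // t v tB vw; rewrite exprS; apply: h.
Qed.

Lemma angle_lipschitz_sum B w n (g : 'I_n -> C -> C -> C) l :
  (forall i, angle_lipschitz B w (g i) (l i)) ->
  angle_lipschitz B w (fun t v => \sum_(i < n) g i t v) (\sum_(i < n) l i).
Proof.
move=> gl; elim: n => [|n IH] in g l gl *.
  by exists 0 => // t v _ _; rewrite !big_ord0 subrr normr0 mul0r.
pose wd := widen_ord (leqnSn n).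
have := angle_lipschitzD (IH (g \o wd) (l \o wd) (fun i => gl _)) (gl ord_max).
by case=> K K0 h; exists K => // t v tB vw; rewrite !big_ord_recr; apply: h.
Qed.

(** The product is a polynomial in t and v = t/(1 - e^(it)), with v within t of i. At t = 0 only the
    top term survives, with coefficient (-1)^q A_{q,q+1} = q!. *)
Lemma efun_cis_asymptotics q : exists2 K : C, 0 <= K &
  forall t : R, 0 < t <= pi ->
  `|t%:C ^+ q.+1 * efun q (cis t) - q`!%:R * (0 +i* 1) ^+ q.+1| <= K * t%:C.
Proof.
pose B : C := (pi : R)%:C; pose w : C := 0 +i* 1.
have B0 : 0 <= B by rewrite lecR pi_ge0.
pose c i : C := (-1) ^+ i * (Acoef q i.+1)%:~R.
have [K K0 h] : angle_lipschitz B w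
    (fun t v => \sum_(i < q.+1) c i * (t ^+ (q - i) * v ^+ i.+1))
    (\sum_(i < q.+1) c i * (0 ^+ (q - i) * w ^+ i.+1)).
  apply: angle_lipschitz_sum => i.
  apply: angle_lipschitzM => //; first exact: angle_lipschitz_const.
  apply: angle_lipschitzM => //; apply: angle_lipschitzX => //.
    exact: angle_lipschitz_t.
  exact: angle_lipschitz_v.
exists K => // t /[dup] tp /andP[t0 tpi].
have := h t%:C (t%:C / (1 - cis t)) _ (norm_recip_cis tp).
rewrite !lecR (ltW t0) tpi => /(_ isT).
rewrite [X in _ - X](_ : _ = q`!%:R * w ^+ q.+1); last first.
  rewrite big_ord_recr /= big1 ?add0r => [|i _]; last first.
    by rewrite expr0n subn_eq0 leqNgt ltn_ord /= mul0r mulr0.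
  by rewrite subnn expr0 mul1r /c Acoef_diag signrMK.
congr (`|_ - _| <= _); rewrite /efun mulr_sumr; apply: eq_bigr => i _.
rewrite [RHS]mulrCA; congr (_ * _); rewrite exprMn mulrA -exprD; congr (_ ^+ _ * _).
by rewrite addnS subnK // -ltnS.
Qed.

End SmallAngleAsymptotics.

(** * The L-value as a limit of the distribution relation *)

Section EvenLValues.
Variable R : realType.
Local Notation C := R[i].
Variables (k : nat) (chi : int -> C).
Hypothesis k1 : (1 < k)%N.
Hypothesis chiD : is_dirichlet_char k chi.
Hypothesis chi_even : chi (- 1) = 1.

Let kR0 : (k%:R : R) != 0. Proof. by rewrite pnatr_eq0; lia. Qed.

Lemma even_char_opp n : chi (- n) = chi n.
Proof. by have [cM _ _] := chiD; rewrite -mulN1r cM chi_even mul1r. Qed.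

Lemma chi_periodic m n : chi (m + n * k%:Z) = chi m.
Proof.
by rewrite -(dirichlet_char_mod _ chiD) addrC modzMDl (dirichlet_char_mod _ chiD).
Qed.

Lemma chi_mul_period n : chi (n * k%:Z) = 0.
Proof.
rewrite -[n * _]add0r chi_periodic; have [_ _ c0] := chiD.
apply/eqP/negPn; rewrite c0 coprimezE /= /coprime gcd0n; lia.
Qed.

Lemma sum_efun_fold (f : nat -> C) (P : nat) :
  f 0 = 0 -> f P = 0 -> (forall n, (n < P)%N -> f (2 * P - n.+1)%N = f n.+1) ->
  \sum_(0 <= n < 2 * P) f n = 2 * \sum_(0 <= n < P) f n.
Proof.
move=> f0 fP fE; rewrite mul2n -addnn (@big_cat_nat _ _ _ P) //=; last lia.
rewrite [2 * _](_ : _ = \sum_(0 <= n < P) f n + \sum_(0 <= n < P) f n); last by ring.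
congr (_ + _).
rewrite -[in LHS](add0n P) big_addn addnK big_nat_rev /= add0n.
have -> : \sum_(0 <= n < P) f n = \sum_(0 <= n < P) f n.+1.
  have <- : \sum_(0 <= n < P.+1) f n = \sum_(0 <= n < P) f n.
    by rewrite big_nat_recr //= fP addr0.
  by rewrite big_nat_recl //= f0 add0r.
apply: eq_big_nat => n /andP[_ nP]; rewrite -fE //; congr f; lia.
Qed.

(** The distribution relation with N = 2J, then folding n to 2kJ - n. As N is even, the midpoint kJ
    is a multiple of [k], where [chi] is 0, and the remaining angles lie below pi. *)
Lemma sum_residues_efun q J : odd q -> (0 < J)%N ->
  (2 * J)%:R ^+ q.+1 * \sum_(0 <= m < k) chi m%:Z * efun q (cis (2 * pi * m%:R / k%:R)) =
  2 * \sum_(0 <= n < k * J) chi n%:Z * efun q (cis (pi * n%:R / (k * J)%:R)).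
Proof.
move=> oq J0; set N := (2 * J)%N; set P := (k * J)%N.
have N0 : (0 < N)%N by rewrite muln_gt0.
have NR0 : N%:R != 0 :> R by rewrite pnatr_eq0; lia.
have PR0 : P%:R != 0 :> R by rewrite pnatr_eq0 muln_eq0; lia.
have JR0 : J%:R != 0 :> R by rewrite pnatr_eq0; lia.
have piP : 0 < pi :> R := pi_gt0 R.
pose f n := chi n%:Z * efun q (cis (pi * n%:R / P%:R)).
rewrite -(@sum_efun_fold f); first last.
- move=> n nP.
  have chiE : chi (2 * P - n.+1)%N%:Z = chi n.+1%:Z.
    rewrite (_ : (2 * P - n.+1)%N = - n.+1%:Z + (2 * J)%:Z * k%:Z :> int); last first.
      by rewrite /P; lia.
    by rewrite chi_periodic even_char_opp.
  rewrite /f chiE.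
  have -> : cis (pi * (2 * P - n.+1)%:R / P%:R : R) =
      (cis (pi * n.+1%:R / P%:R))^-1.
    rewrite natrB; last lia.
    rewrite -cisN (_ : pi * _ / _ = 2 * pi + - (pi * n.+1%:R / P%:R)); last first.
      by rewrite natrM; field.
    by rewrite cisD cis2pi mul1r.
  rewrite efun_odd_inv ?cis_neq0 //; apply: cis_neq1.
  rewrite !mulr_gt0 ?invr_gt0 ?ltr0n //=; last by lia.
  rewrite ltr_pdivrMr ?ltr0n; last by lia.
  rewrite [2 * pi]mulrC -mulrA ltr_pM2l // -natrM ltr_nat; lia.
- by rewrite /f (_ : P%:Z = J%:Z * k%:Z) ?chi_mul_period ?mul0r // /P; lia.
- by rewrite /f -[0%:Z](mul0r k%:Z) chi_mul_period mul0r.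
rewrite (_ : 2 * P = N * k)%N; last by rewrite /N /P; lia.
rewrite big_nat_mul.
transitivity (\sum_(0 <= m < k) chi m%:Z *
    \sum_(0 <= i < N) efun q (cis (pi * (m + i * k)%:R / P%:R))).
  rewrite mulr_sumr; apply: eq_big_nat => m /andP[_ mk].
  have [-> |cm] := eqVneq (chi m%:Z) 0; first by rewrite !mul0r mulr0.
  rewrite mulrCA; congr (_ * _); pose z : C := cis (pi * m%:R / P%:R).
  have zN : z ^+ N = cis (2 * pi * m%:R / k%:R).
    rewrite /z -cis_natmul; congr cis; rewrite /N /P !natrM; field.
    by rewrite JR0 kR0.
  have m0 : (0 < m)%N.
    rewrite lt0n; apply: contraNneq cm => ->.
    by rewrite -[0%:Z](mul0r k%:Z) chi_mul_period.
  have zN1 : z ^+ N != 1.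
    by rewrite zN cis_residue_neq1 // m0.
  rewrite -zN -(efun_distr _ (cis_prim_root R N0) zN1) [RHS]big_mkord.
  apply: eq_bigr => i _; rewrite -cis_natmul -cisD; congr (efun _ (cis _)).
  by rewrite /N /P natrD !natrM; field; rewrite JR0 kR0.
transitivity (\sum_(0 <= m < k) \sum_(0 <= i < N)
    chi m%:Z * efun q (cis (pi * (m + i * k)%:R / P%:R))).
  by apply: eq_bigr => m _; rewrite mulr_sumr.
rewrite exchange_big; apply: eq_big_nat => i _ /=.
rewrite -[in RHS](add0n (i * k)%N) big_addn.
rewrite (_ : i.+1 * k - i * k = k)%N; last by lia.
apply: eq_big_nat => m _; rewrite /f; congr (_ * _).
by rewrite PoszD PoszM chi_periodic.
Qed.

Definition partial_L q M : C := \sum_(0 <= n < M) chi n%:Z * n%:R ^- q.+1.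

(** The constant comes from solving [sum_residues_efun] for the partial L-sum, with each [efun]
    replaced by its small-angle limit. *)
Definition even_L_value q : C :=
  (2 * pi / k%:R : R)%:C ^+ q.+1 / (2 * (q`!%:R * (0 +i* 1) ^+ q.+1)) *
  \sum_(0 <= m < k) chi m%:Z * efun q (cis (2 * pi * m%:R / k%:R)).

Lemma norm_char_le1 n : `|chi n| <= 1.
Proof.
have [->|c0] := eqVneq (chi n) 0; first by rewrite normr0.
by rewrite (norm_dirichlet_char k1 chiD).
Qed.

Lemma sum_inv_sqr_le (F : numFieldType) P :
  \sum_(1 <= n < P.+1) (n%:R : F) ^- 2 <= 2.
Proof.
case: P => [|P]; first by rewrite big_geq.
(* The sharper bound 2 - 1/P makes the induction go through. *)
suff : \sum_(1 <= n < P.+2) (n%:R : F) ^- 2 <= 2 - P.+1%:R^-1.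
  by move/le_trans; apply; rewrite gerBl invr_ge0.
elim: P => [|P IH]; first by rewrite big_nat1 expr1n invr1 -[2]natr1 addrK.
rewrite big_nat_recr //=; apply: le_trans (lerD IH (lexx _)) _.
set a : F := P.+1%:R; have a0 : 0 < a by rewrite ltr0n.
rewrite -[P.+2%:R]natr1 -/a.
have a1 : 0 < a + 1 by rewrite addr_gt0.
rewrite -subr_ge0.
have -> : 2 - (a + 1)^-1 - (2 - a^-1 + (a + 1) ^- 2) = (a * (a + 1) ^+ 2)^-1.
  by field; rewrite !gt_eqF.
by rewrite invr_ge0 mulr_ge0 ?exprn_ge0 ?ltW.
Qed.

(** Termwise the error is at most n^-(q+1) K t_n up to a constant, with t_n = pi n / P. One factor n
    cancels, the sum of n^-q is bounded, and 1/P remains. *)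
Lemma partial_L_full_periods q : odd q -> (1 < q)%N -> exists2 K : C, 0 <= K &
  forall J, (0 < J)%N -> `|partial_L q (k * J) - even_L_value q| <= K / (k * J)%:R.
Proof.
move=> oq q1; have [K K0 hK] := efun_cis_asymptotics R q.
set c : C := q`!%:R * (0 +i* 1) ^+ q.+1.
have c0 : c != 0.
  apply: mulf_neq0; first by rewrite pnatr_eq0 -lt0n fact_gt0.
  by rewrite expf_neq0 // -normr_gt0 norm_imag_unit.
have c'0 : 0 < `|c| by rewrite normr_gt0.
have two0 : 2 != 0 :> C by rewrite pnatr_eq0.
have chi0 : chi 0 = 0 by rewrite -[0](mul0r k%:Z) chi_mul_period.
pose p : C := (pi : R)%:C.
have p0 : 0 < p by rewrite ltcR pi_gt0.
exists (2 * K * p / `|c|); first by rewrite divr_ge0 // mulr_ge0 ?(ltW p0) // mulr_ge0.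
move=> J J0; set P := (k * J)%N.
have P0 : (0 < P)%N by rewrite muln_gt0 J0 (ltnW k1).
have PC0 : P%:R != 0 :> C by rewrite pnatr_eq0 -lt0n.
have JC0 : J%:R != 0 :> C by rewrite pnatr_eq0 -lt0n.
have kC0 : k%:R != 0 :> C by rewrite pnatr_eq0 -lt0n ltnW.
pose t n : R := pi * n%:R / P%:R.
have tC n : (t n)%:C = p * n%:R / P%:R.
  by rewrite /t 2!rmorphM fmorphV /= 2!rmorph_nat.
pose f n := efun q (cis (t n)).
have cL : c * even_L_value q = \sum_(0 <= n < P) chi n%:Z * n%:R ^- q.+1 * ((t n)%:C ^+ q.+1 * f n).
  have S := sum_residues_efun oq J0.
  rewrite -/P in S.
  have -> : c * even_L_value q = (p / P%:R) ^+ q.+1 * (2 * \sum_(0 <= n < P) chi n%:Z * f n) / 2.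
    rewrite -S mulrA -exprMn /even_L_value -/c.
    have -> : (2 * pi / k%:R : R)%:C = p / P%:R * (2 * J)%:R.
      rewrite 2!rmorphM fmorphV /= 2!rmorph_nat /P !natrM -/p; field.
      by rewrite kC0 JC0.
    by field; rewrite c0.
  rewrite [2 * _]mulrC mulrA mulfK // mulr_sumr; apply: eq_big_nat => n _.
  have [-> |n0] := posnP n; first by rewrite chi0 !mul0r mulr0.
  rewrite tC [p * n%:R / _]mulrAC [X in _ = _ * (X * _)]exprMn; set x := (p / _) ^+ _.
  have nC0 : n%:R != 0 :> C by rewrite pnatr_eq0 -lt0n.
  have e0 : n%:R ^+ q.+1 != 0 :> C by rewrite expf_neq0.
  by field.
have -> : partial_L q P - even_L_value q =
    c^-1 * \sum_(0 <= n < P) chi n%:Z * n%:R ^- q.+1 * (c - (t n)%:C ^+ q.+1 * f n).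
  under eq_bigr do rewrite mulrBr.
  by rewrite sumrB -cL -mulr_suml -/(partial_L q P) mulrBr mulKf // mulrCA mulVf // mulr1.
rewrite normrM normfV (_ : 2 * K * p / `|c| / P%:R = `|c|^-1 * (K * p / P%:R * 2)); last first.
  by field; rewrite PC0 gt_eqF.
rewrite ler_wpM2l ?invr_ge0 //; apply: le_trans (ler_norm_sum _ _ _) _.
have B0 : 0 <= K * p / P%:R by rewrite divr_ge0 ?ler0n // mulr_ge0 // (ltW p0).
rewrite -[P in X in X <= _](prednK P0) big_nat_recl //= chi0 !mul0r normr0 add0r.
apply: (@le_trans _ _ (\sum_(1 <= n < P.-1.+1) K * p / P%:R * n%:R ^- 2)); last first.
  by rewrite -mulr_sumr ler_wpM2l // sum_inv_sqr_le.
rewrite big_add1 /= ler_sum_nat // => n /andP[_ nP].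
have nC0 : 0 < n.+1%:R :> C by rewrite ltr0n.
have tn : 0 < t n.+1 <= pi.
  have PR0 : 0 < P%:R :> R by rewrite ltr0n.
  have nPR : n.+1%:R <= P%:R :> R by rewrite ler_nat -(prednK P0) ltnS ltnW.
  rewrite /t divr_gt0 ?mulr_gt0 ?pi_gt0 ?ltr0n //=.
  by rewrite ler_pdivrMr // ler_wpM2l ?pi_ge0.
rewrite !normrM normfV normrX (ger0_norm (ltW nC0)).
apply: (@le_trans _ _ (1 * n.+1%:R ^- q.+1 * (K * (t n.+1)%:C))).
  rewrite ler_pM ?mulr_ge0 ?invr_ge0 ?exprn_ge0 ?ler0n ?normr_ge0 //.
    by rewrite ler_wpM2r ?invr_ge0 ?exprn_ge0 ?ler0n // norm_char_le1.
  by rewrite distrC; apply: hK.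
rewrite tC mul1r mulrC -!mulrA ler_wpM2l // ler_wpM2l ?(ltW p0) //.
rewrite mulrCA ler_wpM2l ?invr_ge0 // exprS invfM mulrA mulfV ?gt_eqF // mul1r.
by rewrite lef_pV2 ?posrE ?exprn_gt0 //; apply: ler_weXn2l; rewrite ?ler1n.
Qed.

(** [M] is rounded down to a multiple P of [k]; fewer than [k] terms remain, each at most 1/P, and M
    <= 2P. *)
Lemma partial_L_error q : odd q -> (1 < q)%N -> exists2 K : C, 0 <= K &
  forall M, (2 * k <= M)%N -> `|partial_L q M - even_L_value q| <= K / M%:R.
Proof.
move=> oq q1; have [K K0 hK] := partial_L_full_periods oq q1.
exists (2 * (k%:R + K)); first by rewrite mulr_ge0 // addr_ge0.
move=> M kM; pose J := (M %/ k)%N; pose P := (k * J)%N.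
have k0 : (0 < k)%N by lia.
have J0 : (0 < J)%N by rewrite divn_gt0 //; lia.
have ME : M = (P + M %% k)%N by rewrite /P /J mulnC -divn_eq.
have Mk := ltn_pmod M k0.
have PM : (M <= 2 * P)%N by lia.
have P0 : 0 < P%:R :> C by rewrite ltr0n muln_gt0 k0.
have M0 : 0 < M%:R :> C by rewrite ltr0n; lia.
apply: (@le_trans _ _ ((k%:R + K) / P%:R)); last first.
  rewrite [2 * _]mulrC -mulrA ler_wpM2l ?addr_ge0 //.
  by rewrite ler_pdivlMr // mulrC ler_pdivrMr // -natrM ler_nat.
rewrite -(subrKA (partial_L q P)) mulrDl.
apply: le_trans (ler_normD _ _) _; rewrite lerD ?hK //.
rewrite /partial_L (@big_cat_nat _ _ _ P 0 M) //=; last by lia.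
rewrite addrAC subrr add0r; apply: le_trans (ler_norm_sum _ _ _) _.
apply: (@le_trans _ _ (\sum_(P <= n < M) P%:R^-1)); last first.
  rewrite sumr_const_nat -[_ *+ (M - P)]mulr_natl ler_wpM2r ?invr_ge0 ?ler0n // ler_nat; lia.
rewrite ler_sum_nat // => n /andP[Pn _].
have Pn0 : (0 < P)%N by rewrite muln_gt0 k0.
have n0 : 0 < n%:R :> C by rewrite ltr0n; lia.
rewrite normrM normfV normrX (ger0_norm (ltW n0)) -[leRHS]mul1r.
rewrite ler_pM ?invr_ge0 ?exprn_ge0 ?norm_char_le1 ?ler0n //.
rewrite lef_pV2 ?posrE ?exprn_gt0 // (@le_trans _ _ n%:R) ?ler_nat //.
by rewrite -[leLHS]expr1 ler_weXn2l // ler1n; lia.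
Qed.

Lemma natcpow_opp_nat n H : natcpow n.+1 (- H%:R : C) = n.+1%:R ^- H.
Proof.
rewrite /natcpow.
have -> : complex.Re (- H%:R : C) = - H%:R.
  by rewrite -(rmorph_nat (real_complex R)) -rmorphN.
have -> : complex.Im (- H%:R : C) = 0.
  by rewrite -(rmorph_nat (real_complex R)) -rmorphN.
rewrite mul0r cos0 sin0 mulNr expRN expRM_natl lnK ?posrE ?ltr0n //.
by rewrite fmorphV rmorphXn /= rmorph_nat [X in _ * X](_ : _ = 1) ?mulr1.
Qed.

Lemma dirichlet_L_even q : odd q -> (1 < q)%N ->
  dirichlet_L q.+1%:R chi = even_L_value q.
Proof.
move=> oq q1; have [K K0 hK] := partial_L_error oq q1.
have chi0 : chi 0 = 0 by rewrite -[0](mul0r k%:Z) chi_mul_period.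
(* The series starts at 1 and [partial_L] at 0, whose term vanishes; hence the shift. *)
have sE n : series (fun n : nat => chi n.+1%:Z * natcpow n.+1 (- q.+1%:R) : C^o) n =
    partial_L q n.+1.
  rewrite /series /= /partial_L big_nat_recl // chi0 mul0r add0r.
  by apply: eq_bigr => i _; rewrite natcpow_opp_nat.
rewrite /dirichlet_L; apply: (cvg_lim (@norm_hausdorff C C^o)).
apply/cvgrPdist_lt => e e0.
(* Comparison with 0 forces [K] and [e] to be real, so the Archimedean bound can be taken in [R]. *)
have [r rE] : exists r : R, K = r%:C.
  by move: K0; case: (K) => a b; rewrite lecE /= => /andP[/eqP -> _]; exists a.
have [d dE] : exists d : R, e = d%:C.
  by move: e0; case: (e) => a b; rewrite ltcE /= => /andP[/eqP -> _]; exists a.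
have d0 : 0 < d by rewrite -ltcR -dE.
pose N := maxn (2 * k) (Num.bound `|r / d|).
near=> n.
have nN : (N <= n)%N by near: n; exact: nbhs_infty_ge.
rewrite distrC sE; apply: le_lt_trans (hK n.+1 _) _.
  by apply: leq_trans (leq_maxl _ (Num.bound `|r / d|)) _; apply: leqW.
rewrite ltr_pdivrMr ?ltr0n // rE dE -(rmorph_nat (real_complex R)) -rmorphM /= ltcR.
rewrite mulrC -ltr_pdivrMr //; apply: le_lt_trans (ler_norm _) _.
apply: lt_le_trans (archi_boundP (normr_ge0 _)) _.
rewrite ler_nat; apply: leq_trans (leq_maxr (2 * k) _) _.
exact: leqW nN.
Unshelve. all: by end_near.
Qed.

End EvenLValues.

(** * Sigma_2' as a sum over residues *)

Section SigmaAsSum.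
Variables (R : realType) (k : nat).
Hypothesis k1 : (1 < k)%N.
Local Notation C := R[i].

Definition coprime_residues := [seq m <- index_iota 1 k.+1 | coprime m k].

Lemma coprime_residues_lt m : m \in coprime_residues -> (0 < m < k)%N.
Proof.
rewrite mem_filter mem_index_iota => /andP[mk /andP[m0]].
rewrite ltnS leq_eqVlt m0 => /predU1P[e|-> //].
by move: mk; rewrite e /coprime gcdnn; lia.
Qed.

Lemma SIN_sum n :
  SIN R k n = \sum_(m <- coprime_residues) 1 / sin (pi * m%:R / k%:R) ^+ n.
Proof. by rewrite /SIN big_filter. Qed.

Lemma sin_residue_neq0 m : m \in coprime_residues -> sin (pi * m%:R / k%:R : R) != 0.
Proof.
move=> /coprime_residues_lt /andP[m0 mk]; rewrite gt_eqF // sin_gt0_pi //.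
have p0 := pi_gt0 R.
rewrite !mulr_gt0 ?invr_gt0 ?ltr0n //=; last lia.
by rewrite -mulrA gtr_pMr // ltr_pdivrMr ?mul1r ?ltr_nat // ltr0n; lia.
Qed.

(** Writing each [SIN] as a sum over residues, the even and odd halves of the bracket are the two
    cases of [recip_pow_re]. *)
Lemma beta_bracket alpha n : (0 < alpha)%N ->
  \sum_(1 <= beta < (n + 1).+1 | ~~ odd (alpha + beta))
  \sum_(0 <= c < ((alpha + beta)./2).+1)
  \sum_(0 <= d < ((alpha + beta - 2 * c)./2).+1)
    (-1) ^+ (c + d + (alpha + beta)./2)
    * (Acoef n beta)%:~R
    * (((alpha + beta) * (alpha + beta - c - 1)`!)%:R
       / (2 ^ (2 * c + 1) * c`! * (alpha + beta - 2 * c)`!)%:R)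
    * 'C((alpha + beta - 2 * c)./2, d)%:R
    * SIN R k (alpha + beta - 2 * d)
  +
  \sum_(1 <= beta < (n + 1).+1 | odd (alpha + beta))
  \sum_(0 <= e < ((alpha + beta - 1)./2).+1)
  \sum_(0 <= f < ((alpha + beta - 2 * e - 1)./2).+1)
    (-1) ^+ (e + f + (alpha + beta + 1)./2)
    * (Acoef n beta)%:~R
    * ((alpha + beta - e - 1)`!%:R
       / (2 ^ (2 * e + 1) * e`! * (alpha + beta - 2 * e - 1)`!)%:R)
    * 'C((alpha + beta - 2 * e - 1)./2, f)%:R
    * SIN R k (alpha + beta - 2 * f - 1) =
  \sum_(m <- coprime_residues) \sum_(1 <= beta < (n + 1).+1)
    (Acoef n beta)%:~R * recip_pow_re (alpha + beta) (pi * m%:R / k%:R).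
Proof.
move=> a0; rewrite exchange_big [RHS](bigID (fun beta => odd (alpha + beta))) /=.
rewrite [RHS]addrC; congr (_ + _).
  (* This retains beta >= 1, so that alpha + beta > 1 as [recip_pow_re_even] requires. *)
  rewrite big_nat_cond [RHS]big_nat_cond.
  apply: eq_bigr => beta /andP[/andP[b0 _] oab].
  transitivity (\sum_(m <- coprime_residues) \sum_(0 <= c < ((alpha + beta)./2).+1)
    \sum_(0 <= d < ((alpha + beta - 2 * c)./2).+1)
      (-1) ^+ (c + d + (alpha + beta)./2) * (Acoef n beta)%:~R
      * (((alpha + beta) * (alpha + beta - c - 1)`!)%:R
         / (2 ^ (2 * c + 1) * c`! * (alpha + beta - 2 * c)`!)%:R)
      * 'C((alpha + beta - 2 * c)./2, d)%:R
      * (1 / sin (pi * m%:R / k%:R : R) ^+ (alpha + beta - 2 * d))).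
    rewrite [RHS]exchange_big; apply: eq_bigr => c _; rewrite [RHS]exchange_big.
    by apply: eq_bigr => d _; rewrite SIN_sum mulr_sumr.
  apply: eq_big_seq => m /sin_residue_neq0 sm.
  rewrite -recip_pow_re_even //; last by lia.
  rewrite mulr_sumr; apply: eq_bigr => c _; rewrite mulr_sumr.
  by apply: eq_bigr => d _; ring.
apply: eq_bigr => beta oab.
transitivity (\sum_(m <- coprime_residues) \sum_(0 <= e < ((alpha + beta - 1)./2).+1)
  \sum_(0 <= f < ((alpha + beta - 2 * e - 1)./2).+1)
    (-1) ^+ (e + f + (alpha + beta + 1)./2) * (Acoef n beta)%:~R
    * ((alpha + beta - e - 1)`!%:R
       / (2 ^ (2 * e + 1) * e`! * (alpha + beta - 2 * e - 1)`!)%:R)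
    * 'C((alpha + beta - 2 * e - 1)./2, f)%:R
    * (1 / sin (pi * m%:R / k%:R : R) ^+ (alpha + beta - 2 * f - 1))).
  rewrite [RHS]exchange_big; apply: eq_bigr => e _; rewrite [RHS]exchange_big.
  by apply: eq_bigr => f _; rewrite SIN_sum mulr_sumr.
apply: eq_big_seq => m /sin_residue_neq0 sm.
rewrite -recip_pow_re_odd // mulr_sumr; apply: eq_bigr => e _; rewrite mulr_sumr.
by apply: eq_bigr => f _; ring.
Qed.

Lemma Re_sum (I : Type) (r : seq I) (F : I -> C) :
  complex.Re (\sum_(i <- r) F i) = \sum_(i <- r) complex.Re (F i).
Proof. by apply: big_morph => // -[a b] [c d]. Qed.

Lemma Re_realM (a : R) (z : C) : complex.Re (a%:C * z) = a * complex.Re z.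
Proof. by case: z => x y /=; rewrite mul0r subr0. Qed.

(** By [bernoulli_inversion] the squared quantity is [T m]; expanding its square in powers of [u m]
    and taking real parts gives the ranges and coefficients of [Sigma2']. *)
Lemma Sigma2'_eq h : (1 < h)%N ->
  Sigma2' R k h = \sum_(m <- coprime_residues)
    complex.Re (((2 * h)%:R * k%:R ^- (2 * h).-1 *
       efun (2 * h).-1 (cis (2 * pi * m%:R / k%:R))) ^+ 2).
Proof.
move=> h1; pose g q j : R := ratr (bernoulli q) * 'C(2 * h, q)%:R * 'C(2 * h - q, j)%:R
  * k%:R ^ (- (2 * h)%N%:Z + q%:Z + j%:Z).
pose u m : C := (1 - cis (2 * pi * m%:R / k%:R))^-1.
pose e n m : C := \sum_(1 <= a < (n + 1).+1) (-1) ^+ a.-1 * (Acoef n a)%:~R * u m ^+ a.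
have k0 : k%:R != 0 :> R by rewrite pnatr_eq0; lia.
have eE n m : efun n (cis (2 * pi * m%:R / k%:R)) = e n m.
  by rewrite /e big_add1 addn1 big_mkord.
pose T m : C := \sum_(0 <= q < (2 * h - 2).+1) \sum_(1 <= j < (2 * h - q).+1)
   (g q j)%:C * e (2 * h - q - j)%N m.
have TE m : (2 * h)%:R * k%:R ^- (2 * h).-1 *
       efun (2 * h).-1 (cis (2 * pi * m%:R / k%:R)) = T m.
  rewrite -(@bernoulli_inversion C (2 * h) k%:R
    (fun n => efun n (cis (2 * pi * m%:R / k%:R)))); first last.
  - by rewrite pnatr_eq0; lia.
  - by rewrite oddM.
  - by lia.
  apply: eq_bigr => q _; apply: eq_bigr => j _; rewrite eE; congr (_ * _).
  rewrite /g 3!rmorphM /= fmorph_rat !rmorph_nat; congr (_ * _).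
  by rewrite fmorphXz rmorph_nat.
under eq_bigr do rewrite TE expr2.
transitivity (\sum_(m <- coprime_residues) \sum_(0 <= q1 < (2 * h - 2).+1)
  \sum_(0 <= q2 < (2 * h - 2).+1)
  \sum_(1 <= j < (2 * h - q1).+1)
  \sum_(1 <= s < (2 * h - q2).+1)
  \sum_(1 <= alpha < (2 * h - q1 - j + 1).+1)
  g q1 j * g q2 s * (Acoef (2 * h - q1 - j) alpha)%:~R *
  \sum_(1 <= beta < (2 * h - q2 - s + 1).+1)
    (Acoef (2 * h - q2 - s) beta)%:~R * recip_pow_re (alpha + beta) (pi * m%:R / k%:R)).
  rewrite [RHS]exchange_big; apply: eq_bigr => q1 _.
  rewrite [RHS]exchange_big; apply: eq_bigr => q2 _.
  rewrite [RHS]exchange_big; apply: eq_bigr => j _.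
  rewrite [RHS]exchange_big; apply: eq_bigr => s _.
  rewrite [RHS]exchange_big; apply: eq_big_nat => alpha /andP[a0 _] /=.
  rewrite -mulr_sumr -beta_bracket //; congr (_ * _ * _).
  rewrite /g.
  have -> : - (4 * h)%N%:Z + q1%:Z + q2%:Z + j%:Z + s%:Z =
    (- (2 * h)%N%:Z + q1%:Z + j%:Z) + (- (2 * h)%N%:Z + q2%:Z + s%:Z) by lia.
  by rewrite [in LHS]expfzDr //; ring.
apply: eq_big_seq => m mk.
rewrite [in RHS]/T mulr_suml Re_sum; apply: eq_bigr => q1 _.
rewrite mulr_sumr Re_sum; apply: eq_bigr => q2 _.
rewrite mulr_suml Re_sum; apply: eq_bigr => j _.
rewrite mulr_sumr Re_sum; apply: eq_bigr => s _.
rewrite [X in complex.Re X]mulrACA -(rmorphM (real_complex R)) Re_realM.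
under eq_bigr do rewrite -mulrA.
rewrite -mulr_sumr; congr (_ * _).
rewrite /e [X in complex.Re X]mulr_suml Re_sum; apply: eq_big_nat => a /andP[a0 _].
rewrite mulr_sumr [X in complex.Re X]mulr_sumr Re_sum; apply: eq_big_nat => b /andP[b0 _].
rewrite [X in complex.Re X]mulrACA -exprD.
have -> : u m = (1 - cis (2 * (pi * m%:R / k%:R)))^-1 by rewrite /u !mulrA.
set A := (Acoef _ a)%:~R; set B := (Acoef _ b)%:~R.
(* The two signs combine to (-1)^(a+b), which cancels the sign in [Re_recip_pow]. *)
have -> : (-1) ^+ a.-1 * (Acoef (2 * h - q1 - j) a)%:~R *
    ((-1) ^+ b.-1 * (Acoef (2 * h - q2 - s) b)%:~R) = ((-1) ^+ (a + b) * (A * B))%:C :> C.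
  have sE : (-1) ^+ (a + b) = (-1) ^+ a.-1 * (-1) ^+ b.-1 :> C.
    rewrite -exprD -signr_odd -[RHS]signr_odd.
    by rewrite (_ : odd (a + b) = odd (a.-1 + b.-1)) //; lia.
  by rewrite 2!rmorphM rmorphXn rmorphN1 /= sE !rmorph_int; ring.
rewrite Re_realM Re_recip_pow ?sin_residue_neq0 //.
by rewrite [RHS]mulrACA -expr2 sqrr_sign mul1r mulrA.
Qed.

End SigmaAsSum.

(** * Second moment over the even characters *)

Section SecondMoment.
Variables (R : realType) (k : nat).
Hypothesis k1 : (1 < k)%N.
Local Notation C := R[i].
Local Notation units := (coprime_residues k).

Lemma mem_coprime_residues m : (m \in units) = (0 < m < k)%N && coprime m k.
Proof.
apply/idP/idP => [mk|/andP[/andP[m0 mk] cm]]; last first.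
  by rewrite mem_filter mem_index_iota cm m0 ltnS ltnW.
by rewrite (coprime_residues_lt k1 mk); move: mk; rewrite mem_filter => /andP[].
Qed.

Lemma sum_over_coprime_residues (chi : int -> C) (F : nat -> C) :
  is_dirichlet_char k chi ->
  \sum_(0 <= m < k) chi m%:Z * F m = \sum_(m <- units) chi m%:Z * F m.
Proof.
move=> Dc; have nc m : ~~ coprime m k -> chi m%:Z * F m = 0.
  by move=> cm; rewrite (dirichlet_char_coprime0 Dc) ?mul0r.
have n0 : ~~ coprime 0 k by rewrite /coprime gcd0n; lia.
have nk : ~~ coprime k k by rewrite /coprime gcdnn; lia.
rewrite big_filter [RHS]big_mkcond /= [RHS]big_nat_recr; last by lia.
rewrite /= (negbTE nk) addr0 big_ltn; last by lia.
rewrite nc // add0r; apply: eq_bigr => m _.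
by case: ifP => // /negbT/nc.
Qed.

Lemma sum_select (F : nat -> C) c : c \in units ->
  \sum_(n <- units) F n * (n == c)%:R = F c.
Proof.
move=> cu; have uu : uniq units by rewrite filter_uniq ?iota_uniq.
rewrite (bigD1_seq c) //= eqxx mulr1 big1 ?addr0 // => n /negbTE ->.
by rewrite mulr0.
Qed.

(** Expanding the square, orthogonality leaves n = m and n = k - m, each with weight phi(k)/2; by
    the symmetry of [F] they contribute equally. *)
Lemma even_second_moment (a : C) (F : nat -> C) :
  (forall m, m \in units -> (F m)^* = F m) ->
  (forall m, m \in units -> F (k - m)%N = F m) ->
  \sum_(chi \in even_dirichlet_chars R k)
    `|a * \sum_(0 <= m < k) chi m%:Z * F m| ^+ 2 =
  `|a| ^+ 2 * (totient k)%:R * \sum_(m <- units) F m ^+ 2.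
Proof.
move=> Freal Fsym.
have finE : finite_set (even_dirichlet_chars R k).
  by apply: finite_even_dirichlet_chars; lia.
pose W m n : C := F m * F n.
have E1 chi : even_dirichlet_chars R k chi ->
    `|a * \sum_(0 <= m < k) chi m%:Z * F m| ^+ 2 =
    `|a| ^+ 2 * \sum_(m <- units) \sum_(n <- units) chi m%:Z * (chi n%:Z)^-1 * W m n.
  move=> [Dc _]; rewrite normrM exprMn; congr (_ * _).
  rewrite sum_over_coprime_residues // normCK rmorph_sum /= big_distrlr /=.
  apply: eq_bigr => m _; apply: eq_big_seq => n nu.
  (* The conjugate of chi(n) is its inverse, since |chi(n)| = 1. *)
  rewrite rmorphM /= Freal // mulrACA; congr (_ * _ * _).
  have cn : chi n%:Z != 0.
    by have [_ _ ->] := Dc; move: nu; rewrite mem_coprime_residues => /andP[].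
  by rewrite invC_norm (norm_dirichlet_char k1 Dc cn) expr1n invr1 mul1r.
transitivity (\sum_(chi \in even_dirichlet_chars R k)
    `|a| ^+ 2 * \sum_(m <- units) \sum_(n <- units) chi m%:Z * (chi n%:Z)^-1 * W m n).
  by apply: eq_fsbigr => chi /set_mem; apply: E1.
rewrite -mulr_fsumr -mulrA; congr (_ * _).
rewrite fsbig_finite //= exchange_big mulr_sumr; apply: eq_big_seq => m mu /=.
rewrite exchange_big /=.
have mk := mu; rewrite mem_coprime_residues in mk; case/andP: mk => /andP[m0 mk] cm.
have mu' : (k - m)%N \in units.
  rewrite mem_coprime_residues; apply/andP; split; first lia.
  move: cm; rewrite /coprime -{1 3}(subnKC (ltnW mk)) gcdnDl gcdnC.
  by rewrite addnC gcdnDl.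
transitivity (\sum_(n <- units) (totient k)%:R / 2 * F m *
    (F n * (n == m)%:R + F n * (n == (k - m)%N)%:R)).
  apply: eq_big_seq => n nu.
  have nk := nu; rewrite mem_coprime_residues in nk; case/andP: nk => /andP[n0 nk] cn.
  have := sum_even_dirichlet_charsV R k1 m%:Z (_ : coprimez n%:Z k).
  rewrite fsbig_finite //= => S; rewrite -mulr_suml S //.
  have -> : (m%:Z == n%:Z %[mod k])%Z = (n == m).
    by rewrite !modz_nat eqz_nat !modn_small // eq_sym.
  have -> : (m%:Z == - n%:Z %[mod k])%Z = (n == (k - m)%N).
    rewrite -(modzDr (- n%:Z) k%:Z) (_ : - n%:Z + k%:Z = (k - n)%N%:Z); last lia.
    by rewrite !modz_nat eqz_nat !modn_small //; lia.
  by rewrite natrD /W; ring.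
rewrite -mulr_sumr big_split /= !sum_select // Fsym // expr2.
by field.
Qed.

End SecondMoment.

(** * Assembly of the identity *)

Lemma conj_efun (C : numClosedFieldType) q (z : C) : (efun q z)^* = efun q z^*.
Proof.
rewrite /efun rmorph_sum; apply: eq_bigr => i _ /=.
rewrite !rmorphM /= !rmorphXn /= rmorphN1 rmorph_int fmorphV rmorphB rmorph1 //.
Qed.

Theorem theorem3p4 (R : realType) (k h : nat) (hk : (3 <= k)%N) (hh : (2 <= h)%N) :
  \sum_(chi \in even_dirichlet_chars R k) `|dirichlet_L (2 * h)%N%:R chi| ^+ 2 =
  (2 ^+ (4 * h - 2) * pi ^+ (4 * h) / ((2 * h)`!%:R ^+ 2 * k%:R ^+ 2)
   * (totient k)%:R * Sigma2' R k h)%:C.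
Proof.
have k1 : (1 < k)%N by lia.
pose q := (2 * h).-1; have qE : (2 * h)%N = q.+1 by rewrite /q; lia.
have oq : odd q by rewrite /q; lia.
pose w m : R[i] := cis (2 * pi * m%:R / k%:R).
have k0 : k%:R != 0 :> R by rewrite pnatr_eq0; lia.
have wV m : (m < k)%N -> w (k - m)%N = (w m)^-1.
  move=> mk; rewrite /w -cisN natrB ?(ltnW mk) //.
  rewrite (_ : 2 * pi * _ / _ = 2 * pi + - (2 * pi * m%:R / k%:R)); last by field.
  by rewrite cisD cis2pi mul1r.
pose F m := efun q (w m).
have w1 m : m \in coprime_residues k -> w m != 1.
  by move=> /(coprime_residues_lt k1); apply: cis_residue_neq1.
have FV m : m \in coprime_residues k -> efun q (w m)^-1 = F m.
  by move=> mu; rewrite efun_odd_inv ?w1 ?cis_neq0.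
have Freal m : m \in coprime_residues k -> (F m)^* = F m.
  by move=> mu; rewrite conj_efun conj_cis cisN FV.
have Fsym m : m \in coprime_residues k -> F (k - m)%N = F m.
  move=> mu; have /andP[_ mk] := coprime_residues_lt k1 mu.
  by rewrite -(FV m mu) /F (wV m mk).
pose a : R[i] := (2 * pi / k%:R : R)%:C ^+ q.+1 / (2 * (q`!%:R * (0 +i* 1) ^+ q.+1)).
transitivity (\sum_(chi \in even_dirichlet_chars R k)
    `|a * \sum_(0 <= m < k) chi m%:Z * F m| ^+ 2).
  apply: eq_fsbigr => chi /set_mem[Dc ce].
  by rewrite qE (dirichlet_L_even k1 Dc ce oq) //; lia.
rewrite even_second_moment // Sigma2'_eq // -/q.
(* Since [F m] is real, both sides reduce to sums of squares in [R]. *)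
pose r m := complex.Re (F m).
have Fr m : m \in coprime_residues k -> F m = (r m)%:C.
  move=> /Freal; rewrite /r; case: (F m) => x y [] /eqP.
  by rewrite eq_sym -subr_eq0 opprK -mulr2n mulrn_eq0 => /eqP ->.
pose A : R := (2 * pi / k%:R) ^+ q.+1 / (2 * q`!%:R).
have aE : `|a| = A%:C.
  rewrite /a normrM normfV !normrM !normrX norm_imag_unit expr1n mulr1 !normr_nat.
  rewrite ger0_norm ?lecR ?divr_ge0 ?mulr_ge0 ?pi_ge0 ?ler0n //.
  rewrite /A [RHS]rmorphM /= fmorphV /= rmorphXn /=; congr (_ / _).
  by rewrite [RHS]rmorphM /= !rmorph_nat.
rewrite aE (eq_big_seq (fun m => (r m ^+ 2)%:C)); last first.
  by move=> m mu; rewrite Fr // rmorphXn.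
rewrite [X in _ = (_ * X)%:C](eq_big_seq (fun m => ((2 * h)%:R * k%:R ^- q) ^+ 2 * r m ^+ 2));
  last first.
  move=> m mu; rewrite -/(F m) Fr //.
  have -> : (2 * h)%:R * k%:R ^- q * (r m)%:C = ((2 * h)%:R * k%:R ^- q * r m)%:C.
    by rewrite 2!rmorphM fmorphV rmorphXn /= !rmorph_nat.
  by rewrite -(rmorphXn (real_complex R)) /= exprMn.
rewrite -mulr_sumr -(rmorph_sum (real_complex R)) -(rmorphXn (real_complex R)).
rewrite -(rmorph_nat (real_complex R)).
rewrite -2!(rmorphM (real_complex R)) /=.
congr (_%:C); set S := \sum_(_ <- _) _.
have -> : (4 * h - 2 = q * 2)%N by rewrite /q; lia.
have -> : (4 * h = q.+1 * 2)%N by rewrite /q; lia.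
(* The factor (2h)^2 from [Sigma2'_eq] turns ((2h)!)^2 into ((2h-1)!)^2, as in the square of [A]. *)
rewrite /A qE factS natrM !exprM !exprS !exprMn !exprVn expr0.
have f0 : q`!%:R != 0 :> R by rewrite pnatr_eq0 -lt0n fact_gt0.
have kq0 : k%:R ^+ q != 0 :> R by rewrite expf_neq0.
have q0 : q.+1%:R != 0 :> R by rewrite pnatr_eq0.
by field; rewrite kq0 k0 f0 addrC natr1 q0.
Qed.
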